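(* Let $A$ and $B$ be groups with a common subgroup $C$ (i.e. $C$ is given with embeddings $C\hookrightarrow A$ and $C\hookrightarrow B$). The free amalgamated product $A *_C B$ is residually nilpotent as soon as the following conditions hold: (1) $A$ and $B$ are torsionfree nilpotent; (2) $C$ is a retract of both $A$ and $B$; (3) $C$ is abelian.
   Context: A group $G$ is residually nilpotent if every non-trivial element of $G$ has a non-trivial image in some nilpotent quotient of $G$. A subgroup $C$ of a group $H$ is a retract of $H$ if there is a homomorphism $\varphi\colon H\to C$ whose restriction to $C$ is the identity (equivalently $H=\ker(\varphi)\rtimes C$). *)

(* Defs.v *)
(* Groups are [groupType]s: carriers may be infinite, 1 and * are those of
   [group_scope]. *)
From HB Require Import structures.
From mathcomp Require Import all_boot.
From mathcomp Require Import boolp classical_sets.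

Set Implicit Arguments.
Unset Strict Implicit.
Unset Printing Implicit Defensive.

Import Algebra.

Local Open Scope classical_set_scope.
Local Open Scope group_scope.
Local Open Scope quotient_scope.

Notation "{ 'ghom' G -> H }" := (UMagmaMorphism.type G H)
  (at level 0, G at level 98, H at level 99, format "{ 'ghom'  G  ->  H }")
  : type_scope.

Definition torsion_free (G : groupType) : Prop :=
  forall (x : G) (n : nat), (0 < n)%N -> x ^+ n = 1 -> x = 1.

Definition abelian_group (G : groupType) : Prop :=
  forall x y : G, commute x y.

Inductive generated (G : groupType) (S : set G) : set G :=
| generated_mem x : S x -> generated S x
| generated1 : generated S 1
| generatedM x y : generated S x -> generated S y -> generated S (x * y)
| generatedV x : generated S x -> generated S x^-1.

(* The numbering starts at 0: [lower_central G 0] is the whole of G. *)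
Fixpoint lower_central (G : groupType) (n : nat) {struct n} : set G :=
  if n is m.+1 then
    generated [set z | exists x y : G, lower_central m x /\ z = [~ x, y]]
  else setT.
Arguments lower_central : clear implicits.

Definition nilpotent_group (G : groupType) : Prop :=
  exists n, lower_central G n = [set 1].

(* Quotients of G are presented as surjective homomorphisms from G. *)
Definition residually_nilpotent (G : groupType) : Prop :=
  forall g : G, g <> 1 ->
    exists (Q : groupType) (q : {ghom G -> Q}),
      [/\ nilpotent_group Q, (forall y, exists x, q x = y) & q g <> 1].

(* For an embedding i of C in H: the subgroup i(C) is a retract of H. *)
Definition retract (C H : groupType) (i : {ghom C -> H}) : Prop :=
  exists r : {ghom H -> C}, forall c : C, r (i c) = c.

Section Amalgam.
Variables (A B C : groupType) (iA : {ghom C -> A}) (iB : {ghom C -> B}).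

(* The least congruence on the free monoid of words over the disjoint union
   of A and B that makes A and B multiplicative and identifies the two copies
   of C. *)
Inductive amalgam_eq : seq (A + B) -> seq (A + B) -> Prop :=
| amalgam_refl u : amalgam_eq u u
| amalgam_sym u v : amalgam_eq u v -> amalgam_eq v u
| amalgam_trans u v w : amalgam_eq u v -> amalgam_eq v w -> amalgam_eq u w
| amalgam_cat u u' v v' :
    amalgam_eq u u' -> amalgam_eq v v' -> amalgam_eq (u ++ v) (u' ++ v')
| amalgam_1l : amalgam_eq [:: inl 1] [::]
| amalgam_1r : amalgam_eq [:: inr 1] [::]
| amalgam_Ml a a' : amalgam_eq [:: inl a; inl a'] [:: inl (a * a')]
| amalgam_Mr b b' : amalgam_eq [:: inr b; inr b'] [:: inr (b * b')]
| amalgam_glue c : amalgam_eq [:: inl (iA c)] [:: inr (iB c)].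

Definition amalgam_rel : rel (seq (A + B)) := fun u v => `[< amalgam_eq u v >].

Fact amalgam_rel_refl : reflexive amalgam_rel.
Proof. by move=> u; apply/asboolP; exact: amalgam_refl. Qed.

Fact amalgam_rel_sym : symmetric amalgam_rel.
Proof. by move=> u v; apply: asbool_equiv_eq; split; exact: amalgam_sym. Qed.

Fact amalgam_rel_trans : transitive amalgam_rel.
Proof.
move=> v u w /asboolP uv /asboolP vw.
by apply/asboolP; exact: amalgam_trans uv vw.
Qed.

Canonical amalgam_equiv :=
  EquivRel amalgam_rel amalgam_rel_refl amalgam_rel_sym amalgam_rel_trans.

Definition amalgam : Type := {eq_quot amalgam_equiv}.

HB.instance Definition _ := Choice.on amalgam.

Definition amalgam_pi (u : seq (A + B)) : amalgam :=
  \pi_({eq_quot amalgam_equiv})%qT u.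

Lemma amalgam_piP u v : amalgam_pi u = amalgam_pi v <-> amalgam_eq u v.
Proof.
split; first by move/eqquotP => /asboolP.
by move=> uv; apply/eqquotP/asboolP.
Qed.

Lemma amalgam_pi_surj (x : amalgam) : exists u, x = amalgam_pi u.
Proof.
by exists (repr (x : {eq_quot amalgam_equiv})); rewrite /amalgam_pi reprK.
Qed.

Definition amalgam_letterV (l : A + B) : A + B :=
  match l with inl a => inl a^-1 | inr b => inr b^-1 end.

Definition amalgam_wordV (u : seq (A + B)) := rev (map amalgam_letterV u).

Lemma amalgam_eq_wordV u v :
  amalgam_eq u v -> amalgam_eq (amalgam_wordV u) (amalgam_wordV v).
Proof.
rewrite /amalgam_wordV; elim=> {u v} /=.
- by move=> u; exact: amalgam_refl.
- by move=> u v _; exact: amalgam_sym.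
- by move=> u v w _ uv _; exact: amalgam_trans uv.
- by move=> u u' v v' _ uu' _ vv'; rewrite !map_cat !rev_cat; exact: amalgam_cat.
- by rewrite invg1; exact: amalgam_1l.
- by rewrite invg1; exact: amalgam_1r.
- by move=> a a'; rewrite /rev /= invgM; exact: amalgam_Ml.
- by move=> b b'; rewrite /rev /= invgM; exact: amalgam_Mr.
- by move=> c; rewrite /rev /= -!gmulfV; exact: amalgam_glue.
Qed.

Lemma amalgam_wordVl u : amalgam_eq (amalgam_wordV u ++ u) [::].
Proof.
elim: u => [|l u IH]; first exact: amalgam_refl.
rewrite /amalgam_wordV /= rev_cons -cats1 -catA.
apply: amalgam_trans IH; apply: amalgam_cat; first exact: amalgam_refl.
rewrite -[X in amalgam_eq _ X]cat0s -(cat1s l) catA.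
apply: amalgam_cat; last exact: amalgam_refl.
case: l => [a|b] /=.
- by apply: amalgam_trans (amalgam_Ml _ _) _; rewrite mulVg; exact: amalgam_1l.
- by apply: amalgam_trans (amalgam_Mr _ _) _; rewrite mulVg; exact: amalgam_1r.
Qed.

Lemma amalgam_wordVK u : amalgam_wordV (amalgam_wordV u) = u.
Proof.
rewrite /amalgam_wordV map_rev revK -map_comp map_id_in // => -[a|b] _ /=;
  by rewrite invgK.
Qed.

Definition amalgam_mul (x y : amalgam) : amalgam :=
  amalgam_pi (repr (x : {eq_quot amalgam_equiv}) ++
              repr (y : {eq_quot amalgam_equiv})).

Definition amalgam_inv (x : amalgam) : amalgam :=
  amalgam_pi (amalgam_wordV (repr (x : {eq_quot amalgam_equiv}))).

Fact amalgam_repr u :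
  amalgam_eq (repr (amalgam_pi u : {eq_quot amalgam_equiv})) u.
Proof. by apply/amalgam_piP; rewrite /amalgam_pi reprK. Qed.

Lemma amalgam_pi_cat u v :
  amalgam_mul (amalgam_pi u) (amalgam_pi v) = amalgam_pi (u ++ v).
Proof. by apply/amalgam_piP; apply: amalgam_cat; exact: amalgam_repr. Qed.

Lemma amalgam_pi_wordV u :
  amalgam_inv (amalgam_pi u) = amalgam_pi (amalgam_wordV u).
Proof. by apply/amalgam_piP; apply: amalgam_eq_wordV; exact: amalgam_repr. Qed.

Fact amalgam_mulA : associative amalgam_mul.
Proof.
move=> x y z; have [u ->] := amalgam_pi_surj x.
have [v ->] := amalgam_pi_surj y; have [w ->] := amalgam_pi_surj z.
by rewrite !amalgam_pi_cat catA.
Qed.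

Fact amalgam_mul1 : left_id (amalgam_pi [::]) amalgam_mul.
Proof. by move=> x; have [u ->] := amalgam_pi_surj x; rewrite amalgam_pi_cat. Qed.

Fact amalgam_mulr1 : right_id (amalgam_pi [::]) amalgam_mul.
Proof.
by move=> x; have [u ->] := amalgam_pi_surj x; rewrite amalgam_pi_cat cats0.
Qed.

Fact amalgam_mulV : left_inverse (amalgam_pi [::]) amalgam_inv amalgam_mul.
Proof.
move=> x; have [u ->] := amalgam_pi_surj x.
by rewrite amalgam_pi_wordV amalgam_pi_cat; apply/amalgam_piP/amalgam_wordVl.
Qed.

Fact amalgam_mulrV : right_inverse (amalgam_pi [::]) amalgam_inv amalgam_mul.
Proof.
move=> x; have [u ->] := amalgam_pi_surj x.
rewrite amalgam_pi_wordV amalgam_pi_cat; apply/amalgam_piP.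
by rewrite -{1}(amalgam_wordVK u); exact: amalgam_wordVl.
Qed.

HB.instance Definition _ := isGroup.Build amalgam amalgam_mulA amalgam_mul1
  amalgam_mulr1 amalgam_mulV amalgam_mulrV.

Definition amalgam_inl (a : A) : amalgam := amalgam_pi [:: inl a].
Definition amalgam_inr (b : B) : amalgam := amalgam_pi [:: inr b].

Fact amalgam_inl_morph : monoid_morphism amalgam_inl.
Proof.
split; first by apply/amalgam_piP/amalgam_1l.
move=> x y; rewrite [RHS]amalgam_pi_cat.
by apply/amalgam_piP/amalgam_sym/amalgam_Ml.
Qed.

Fact amalgam_inr_morph : monoid_morphism amalgam_inr.
Proof.
split; first by apply/amalgam_piP/amalgam_1r.
move=> x y; rewrite [RHS]amalgam_pi_cat.
by apply/amalgam_piP/amalgam_sym/amalgam_Mr.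
Qed.

HB.instance Definition _ :=
  isUMagmaMorphism.Build A amalgam amalgam_inl amalgam_inl_morph.
HB.instance Definition _ :=
  isUMagmaMorphism.Build B amalgam amalgam_inr amalgam_inr_morph.

Lemma amalgam_inl_inr (c : C) : amalgam_inl (iA c) = amalgam_inr (iB c).
Proof. by apply/amalgam_piP/amalgam_glue. Qed.

Section UniversalProperty.
Variables (K : groupType) (f : {ghom A -> K}) (g : {ghom B -> K}).
Hypothesis fg : forall c, f (iA c) = g (iB c).

Definition amalgam_word_lift (u : seq (A + B)) : K :=
  \prod_(l <- u) match l with inl a => f a | inr b => g b end.

Definition amalgam_lift (x : amalgam) : K :=
  amalgam_word_lift (repr (x : {eq_quot amalgam_equiv})).

Lemma amalgam_lift_pi u : amalgam_lift (amalgam_pi u) = amalgam_word_lift u.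
Proof.
have := amalgam_repr u; rewrite /amalgam_lift; move: (repr _) => v.
rewrite /amalgam_word_lift; elim=> {u v} //=.
- by move=> u v w _ -> _ ->.
- by move=> u u' v v' _ uu' _ vv'; rewrite !big_cat /= uu' vv'.
- by rewrite big_seq1 big_nil gmulf1.
- by rewrite big_seq1 big_nil gmulf1.
- by move=> a a'; rewrite big_cons !big_seq1 gmulfM.
- by move=> b b'; rewrite big_cons !big_seq1 gmulfM.
- by move=> c; rewrite !big_seq1.
Qed.

Fact amalgam_lift_morph : monoid_morphism amalgam_lift.
Proof.
split; first by rewrite amalgam_lift_pi /amalgam_word_lift big_nil.
move=> x y; have [u ->] := amalgam_pi_surj x; have [v ->] := amalgam_pi_surj y.
by rewrite [_ * _]amalgam_pi_cat !amalgam_lift_pi /amalgam_word_lift big_cat.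
Qed.

End UniversalProperty.

Theorem amalgam_universal (K : groupType)
    (f : {ghom A -> K}) (g : {ghom B -> K}) :
  (forall c, f (iA c) = g (iB c)) ->
  exists h : {ghom amalgam -> K},
    [/\ forall a, h (amalgam_inl a) = f a,
        forall b, h (amalgam_inr b) = g b &
        forall h' : {ghom amalgam -> K},
          (forall a, h' (amalgam_inl a) = f a) ->
          (forall b, h' (amalgam_inr b) = g b) -> forall x, h' x = h x].
Proof.
move=> fg.
pose hm := isUMagmaMorphism.Build amalgam K _ (amalgam_lift_morph fg).
pose h : {ghom amalgam -> K} := HB.pack (amalgam_lift f g) hm.
exists h; split.
- by move=> a; rewrite /h /= amalgam_lift_pi // /amalgam_word_lift big_seq1.
- by move=> b; rewrite /h /= amalgam_lift_pi // /amalgam_word_lift big_seq1.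
move=> h' h'l h'r x; have [u ->] := amalgam_pi_surj x.
rewrite /h /= amalgam_lift_pi // /amalgam_word_lift.
elim: u => [|l u IH]; first by rewrite big_nil [LHS]gmulf1.
rewrite big_cons -IH -cat1s -amalgam_pi_cat [LHS]gmulfM.
by congr (_ * _); case: l => ?; [exact: h'l | exact: h'r].
Qed.

End Amalgam.

(* Main.v *)
(* Write [K_A], [K_B] for the kernels of the retractions, so that the amalgam is
   [G = (K_A * K_B) : C] (a semidirect product).  A rational function on a group is
   polynomial of degree less than [n] if all its [n]-fold differences vanish; such
   a function is constant on the [n]-th term of the lower central series, so it
   suffices to separate every [g <> 1] from [1] by a polynomial function on [G].
   If [g] survives in the abelian group [C] this is clear; otherwise [g] is a
   nonempty alternating product [x_1 ... x_l] of nontrivial elements of [K_A], [K_B].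

   A torsion-free nilpotent group has enough polynomial functions (Jennings): one
   starts with a homomorphism on a central cyclic subgroup and extends it, by
   Zorn's lemma, along the upper central series.  As conjugation by [C] is
   unipotent, a polynomial function on [K_A] extends to a right [C]-invariant
   polynomial function on [A]; hence there are such functions [psi_i] with
   [psi_i x_i <> psi_i 1].  From them a discrete iterated integral builds a
   polynomial function on [G] which vanishes on words with fewer than [l] letters
   and takes the value [\prod_i (psi_i x_i - psi_i 1)] at [g]. *)
Require Import Defs.
From HB Require Import structures.
From mathcomp Require Import all_boot all_order all_algebra.
From mathcomp Require Import boolp classical_sets.
From mathcomp Require Import zify ring lra.

Set Implicit Arguments.
Unset Strict Implicit.
Unset Printing Implicit Defensive.

Import Algebra GRing.Theory.

Local Open Scope classical_set_scope.
Local Open Scope ring_scope.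

(** * Polynomial functions on groups *)

Definition ldiff (G : groupType) (x : G) (f : G -> rat) : G -> rat :=
  fun y => f (x * y)%g - f y.

Fixpoint polyfun (G : groupType) (n : nat) (f : G -> rat) : Prop :=
  if n is m.+1 then forall x, polyfun m (ldiff x f) else forall x, f x = 0.

Section PolyFun.
Variable G : groupType.
Implicit Types (f g : G -> rat) (x y : G) (m n : nat).

Lemma polyfun0 n : polyfun n (fun _ : G => 0).
Proof. by elim: n => //=. Qed.

Lemma polyfunS n f : polyfun n f -> polyfun n.+1 f.
Proof.
elim: n f => [f f0 x y|n IH f Hf x]; first by rewrite /ldiff !f0 subrr.
exact/IH/Hf.
Qed.

Lemma polyfun_cst c : polyfun 1 (fun _ : G => c).
Proof. by move=> x y; rewrite /ldiff subrr. Qed.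

Lemma polyfunD n f g :
  polyfun n f -> polyfun n g -> polyfun n (fun x => f x + g x).
Proof.
elim: n f g => [f g f0 g0 x|n IH f g Hf Hg x]; first by rewrite f0 g0 addr0.
rewrite (_ : ldiff _ _ = fun y => ldiff x f y + ldiff x g y); first exact: IH.
by apply/funext => y; rewrite /ldiff; ring.
Qed.

Lemma polyfunN n f : polyfun n f -> polyfun n (fun x => - f x).
Proof.
elim: n f => [f f0 x|n IH f Hf x]; first by rewrite f0 oppr0.
rewrite (_ : ldiff _ _ = fun y => - ldiff x f y); first exact: IH.
by apply/funext => y; rewrite /ldiff; ring.
Qed.

Lemma polyfunB n f g :
  polyfun n f -> polyfun n g -> polyfun n (fun x => f x - g x).
Proof. by move=> Hf /polyfunN; exact: polyfunD. Qed.

(** Translation by [x] turns the difference along [y] into the difference along the conjugate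
    [x * y * x^-1]. *)
Lemma polyfun_ltrans n f x : polyfun n f -> polyfun n (fun y => f (x * y)%g).
Proof.
elim: n f => [f f0 y|n IH f Hf y]; first exact: f0.
rewrite (_ : ldiff _ _ = fun z => ldiff (x * y * x^-1)%g f (x * z)%g).
  exact: IH.
by apply/funext => z; rewrite /ldiff !mulgA mulgVK.
Qed.

(** Left and right differences commute, and at a given point [y] right multiplication by [x] is left
    multiplication by [y * x * y^-1]. *)
Lemma polyfun_rdiff n f x :
  polyfun n.+1 f -> polyfun n (fun y => f (y * x)%g - f y).
Proof.
elim: n f => [f Hf y|n IH f Hf y].
  have := Hf (y * x * y^-1)%g y; rewrite /ldiff mulgVK; exact.
rewrite (_ : ldiff _ _ = fun z => ldiff y f (z * x)%g - ldiff y f z).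
  exact/IH/Hf.
by apply/funext => z; rewrite /ldiff !mulgA; ring.
Qed.

Lemma polyfun_rtrans n f x : polyfun n f -> polyfun n (fun y => f (y * x)%g).
Proof.
move=> Hf; rewrite (_ : (fun _ => _) = fun y => (f (y * x)%g - f y) + f y).
  by apply: polyfunD => //; exact/polyfun_rdiff/polyfunS.
by apply/funext => y; rewrite subrK.
Qed.

(** Inversion exchanges left and right differences. *)
Lemma polyfun_inv n f : polyfun n f -> polyfun n (fun x => f (x^-1)%g).
Proof.
elim: n f => [f f0 x|n IH f Hf x]; first exact: f0.
have := IH _ (polyfun_rdiff (x^-1)%g Hf).
rewrite (_ : ldiff x _ = fun z => f (z^-1 * x^-1)%g - f (z^-1)%g) //.
by apply/funext => z; rewrite /ldiff invgM.
Qed.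

(** Discrete Leibniz rule: in each of the three terms of the difference the two bounds have a
    smaller sum. *)
Lemma polyfunM m n f g :
  polyfun m f -> polyfun n g -> polyfun (m + n) (fun x => f x * g x).
Proof.
move: {2}(m + n)%N (erefl (m + n)%N) => k.
elim: k m n f g => [|k IH] m n f g.
  by move/eqP; rewrite addn_eq0 => /andP[/eqP-> /eqP->] f0 _ x; rewrite f0 mul0r.
case: m => [_ f0 _|m].
  rewrite (_ : (fun x => _) = fun=> 0); first exact: polyfun0.
  by apply/funext => x; rewrite f0 mul0r.
case: n => [_ _ g0|n].
  rewrite (_ : (fun x => _) = fun=> 0); first exact: polyfun0.
  by apply/funext => x; rewrite g0 mulr0.
move=> mnk Hf Hg; rewrite addSn => x.
  change (polyfun (m + n.+1)%N (ldiff x (fun y => f y * g y))).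
rewrite (_ : ldiff _ _ = fun y =>
  ldiff x f y * ldiff x g y + (f y * ldiff x g y + ldiff x f y * g y)).
  apply: polyfunD; last apply: polyfunD.
  - by apply: (IH m n.+1) (polyfunS (Hg x)); [lia | exact: Hf].
  - by rewrite -addSnnS; apply: (IH m.+1 n) (Hg x); [lia | exact: Hf].
  - by apply: (IH m n.+1) Hg; [lia | exact: Hf].
by apply/funext => y; rewrite /ldiff; ring.
Qed.

(** Up to a translation, the difference along a commutator is the commutator of two difference
    operators, so degree losses add up. The loss is [j.+1] because the series is numbered from
    [0]. *)
Lemma polyfun_lower_central n f j z :
  polyfun n f -> lower_central G j z -> polyfun (n - j.+1) (ldiff z f).
Proof.
have polyfun_pred k h x : polyfun k h -> polyfun k.-1 (ldiff x h).
  by case: k => [h0 y|k Hh] /=; [rewrite /ldiff !h0 subrr | exact: Hh].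
elim: j n f z => [|j IH] n f z Hf; first by rewrite subn1 => _; exact: polyfun_pred.
rewrite /= => jz; elim: jz => {z} [z [x [y [jx ->]]]|||].
(* [g] absorbs the factor [x^-1 * y^-1] of the commutator; it remains to compare [g] at [x * y * w]
   and at [y * x * w]. *)
- pose g w := f (x^-1 * y^-1 * w)%g.
  have Hg : polyfun n g by exact: polyfun_ltrans.
  rewrite (_ : ldiff _ _ =
    fun w => ldiff y (ldiff x g) w - ldiff x (ldiff y g) w).
    apply: polyfunB.
      rewrite (_ : (n - j.+2)%N = (n - j.+1).-1); last by lia.
      exact/polyfun_pred/IH.
    rewrite (_ : (n - j.+2)%N = (n.-1 - j.+1)%N); last by lia.
    exact/IH/jx/polyfun_pred.
  apply/funext => w; rewrite /ldiff /g /commg /conjg !mulgA !mulgVK.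
  by rewrite mulVg mul1g; ring.
- rewrite (_ : ldiff _ _ = fun=> 0); first exact: polyfun0.
  by apply/funext => w; rewrite /ldiff mul1g subrr.
- move=> x y _ IHx _ IHy.
  rewrite (_ : ldiff _ _ = fun w => ldiff x f (y * w)%g + ldiff y f w).
    by apply: polyfunD; [apply/polyfun_ltrans/IHx | exact: IHy].
  by apply/funext => w; rewrite /ldiff mulgA; ring.
- move=> x _ IHx.
  rewrite (_ : ldiff _ _ = fun w => - ldiff x f (x^-1 * w)%g).
    exact/polyfunN/polyfun_ltrans/IHx.
  by apply/funext => w; rewrite /ldiff mulVKg; ring.
Qed.

End PolyFun.

Lemma polyfun_comp (G H : groupType) (phi : G -> H) n (f : H -> rat) :
  {morph phi : x y / (x * y)%g} -> polyfun n f -> polyfun n (f \o phi).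
Proof.
move=> phiM; elim: n f => [f f0 x|n IH f Hf x] /=; first exact: f0.
rewrite (_ : ldiff _ _ = ldiff (phi x) f \o phi); first exact/IH/Hf.
by apply/funext => y; rewrite /ldiff /= phiM.
Qed.

(** * Quotient groups and residual nilpotence *)

Record normal_subgroup (G : groupType) (N : set G) : Prop := NormalSubgroup {
  normal1 : N 1%g;
  normalM : forall x y, N x -> N y -> N (x * y)%g;
  normalV : forall x, N x -> N (x^-1)%g;
  normalJ : forall x y, N x -> N (x ^ y)%g
}.

Section Quotient.
Local Open Scope group_scope.
Local Open Scope quotient_scope.
Variables (G : groupType) (N : set G) (nN : normal_subgroup N).

Definition coset_rel : rel G := fun x y => `[< N (x^-1 * y) >].

Fact coset_rel_refl : reflexive coset_rel.
Proof. by move=> x; apply/asboolP; rewrite mulVg; exact: normal1. Qed.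

Fact coset_rel_sym : symmetric coset_rel.
Proof.
by move=> x y; apply: asbool_equiv_eq; split=> /(normalV nN); rewrite invgM invgK.
Qed.

Fact coset_rel_trans : transitive coset_rel.
Proof.
move=> y x z /asboolP xy /asboolP yz; apply/asboolP.
by have := normalM nN xy yz; rewrite mulgA mulgK.
Qed.

Canonical coset_equiv :=
  EquivRel coset_rel coset_rel_refl coset_rel_sym coset_rel_trans.

Definition quotient_group : Type := {eq_quot coset_equiv}.

HB.instance Definition _ := Choice.on quotient_group.

Definition qpi (x : G) : quotient_group := \pi_({eq_quot coset_equiv})%qT x.
Definition qrepr (x : quotient_group) : G := repr (x : {eq_quot coset_equiv}).

Lemma qpiP x y : qpi x = qpi y <-> N (x^-1 * y).
Proof.
by split=> [/eqquotP/asboolP|xy] //; apply/eqquotP/asboolP.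
Qed.

Lemma qreprK x : qpi (qrepr x) = x. Proof. exact: reprK. Qed.

Lemma qpi_surj y : exists x, qpi x = y. Proof. by exists (qrepr y); exact: qreprK. Qed.

Definition qmul (x y : quotient_group) := qpi (qrepr x * qrepr y).
Definition qinv (x : quotient_group) := qpi (qrepr x)^-1.

Lemma qpiM x y : qmul (qpi x) (qpi y) = qpi (x * y).
Proof.
apply/qpiP; rewrite invgM.
have /qpiP Nx : qpi (qrepr (qpi x)) = qpi x by exact: qreprK.
have /qpiP Ny : qpi (qrepr (qpi y)) = qpi y by exact: qreprK.
have := normalM nN (normalJ nN (qrepr (qpi y)) Nx) Ny.
by rewrite /conjg !mulgA mulgK.
Qed.

Lemma qpiV x : qinv (qpi x) = qpi x^-1.
Proof.
apply/qpiP; rewrite invgK.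
have /qpiP Nx : qpi x = qpi (qrepr (qpi x)) by rewrite qreprK.
by have := normalJ nN x^-1 Nx; rewrite /conjg invgK !mulgA mulgV mul1g.
Qed.

Fact qmulA : associative qmul.
Proof.
move=> x y z; rewrite -(qreprK x) -(qreprK y) -(qreprK z).
by rewrite !qpiM mulgA.
Qed.

Fact qmul1 : left_id (qpi 1) qmul.
Proof. by move=> x; rewrite -(qreprK x) qpiM mul1g. Qed.

Fact qmulr1 : right_id (qpi 1) qmul.
Proof. by move=> x; rewrite -(qreprK x) qpiM mulg1. Qed.

Fact qmulV : left_inverse (qpi 1) qinv qmul.
Proof. by move=> x; rewrite -(qreprK x) qpiV qpiM mulVg. Qed.

Fact qmulrV : right_inverse (qpi 1) qinv qmul.
Proof. by move=> x; rewrite -(qreprK x) qpiV qpiM mulgV. Qed.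

HB.instance Definition _ :=
  isGroup.Build quotient_group qmulA qmul1 qmulr1 qmulV qmulrV.

Fact qpi_morph : monoid.monoid_morphism qpi.
Proof. by split=> [|x y]; [|rewrite -qpiM]. Qed.

HB.instance Definition _ := isUMagmaMorphism.Build G quotient_group qpi qpi_morph.

Lemma qpi_eq1 x : qpi x = 1 <-> N x.
Proof.
split=> [/esym/qpiP|Nx]; first by rewrite invg1 mul1g.
by apply/esym/qpiP; rewrite invg1 mul1g.
Qed.

End Quotient.

Lemma lower_central_normal (G : groupType) n : normal_subgroup (lower_central G n).
Proof.
case: n => [|n]; first by split.
split=> [|x y|x|x y]; [exact: generated1|exact: generatedM|exact: generatedV|].
have Hc z t : lower_central G n.+1 z -> lower_central G n.+1 (z ^ t)%g.
  have lcJ m : forall z t, lower_central G m z -> lower_central G m (z ^ t)%g.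
    elim: m => // m IH {}z {}t; elim=> {z} [z [a [b [ma ->]]]|||].
    - apply: generated_mem; exists (a ^ t)%g, (b ^ t)%g.
      by rewrite conjRg; split=> //; exact: IH.
    - by rewrite conj1g; exact: generated1.
    - by move=> a b _ Ha _ Hb; rewrite conjMg; exact: generatedM.
    - by move=> a _ Ha; rewrite conjVg; exact: generatedV.
  exact: lcJ.
exact: Hc.
Qed.

Lemma lower_central_image (G H : groupType) (phi : {ghom G -> H}) n y :
  (forall y, exists x, phi x = y) ->
  lower_central H n y -> exists2 x, lower_central G n x & phi x = y.
Proof.
move=> phi_surj; elim: n y => [y _|n IH y].
  by have [x] := phi_surj y; exists x.
elim=> {y} [y [a [b [/IH[a' na <-] ->]]]|||].
- have [b' <-] := phi_surj b; exists [~ a', b']%g; last exact: gmulfR.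
  by apply: generated_mem; exists a', b'.
- by exists 1%g; [exact: generated1 | exact: gmulf1].
- move=> _ _ _ [a na <-] _ [b nb <-].
  by exists (a * b)%g; [exact: generatedM | exact: gmulfM].
- by move=> _ _ [a na <-]; exists (a^-1)%g; [exact: generatedV | exact: gmulfV].
Qed.

(** The quotient by [lower_central G n] serves: a surjection maps the lower central series onto that
    of its target, so the [n]-th term there is trivial. *)
Lemma residually_nilpotent_lower_central (G : groupType) :
  (forall g : G, g <> 1%g -> exists n, ~ lower_central G n g) ->
  residually_nilpotent G.
Proof.
move=> sepG g /sepG[n ng].
have nN := lower_central_normal G n.
exists (quotient_group nN), (qpi nN : {ghom G -> quotient_group nN}).
split; [|exact: qpi_surj|by move/qpi_eq1].
exists n; apply/seteqP; split=> y /=; last by move=> ->; exact: normal1 (lower_central_normal _ _).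
by case/(lower_central_image (@qpi_surj _ _ nN)) => x nx <-; apply/qpi_eq1.
Qed.

(** For [j = n] the truncated bound [n - n.+1] is [0]: differences along elements of
    [lower_central G n] vanish, in particular at [1]. *)
Lemma polyfun_separates (G : groupType) n (f : G -> rat) g :
  polyfun n f -> f g <> f 1%g -> exists m, ~ lower_central G m g.
Proof.
move=> Hf fg; exists n => /(polyfun_lower_central Hf).
rewrite (_ : (n - n.+1)%N = 0%N); last by lia.
by move=> /(_ 1%g)/eqP; rewrite /ldiff mulg1 subr_eq0 => /eqP.
Qed.

(** * Upper central series *)

Fixpoint upper_central (G : groupType) (n : nat) : set G :=
  if n is m.+1 then [set x | forall y, upper_central m [~ x, y]%g] else [set 1%g].
Arguments upper_central : clear implicits.

Section UpperCentral.
Variable G : groupType.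
Implicit Types x y z : G.

Lemma upper_central_normal n : normal_subgroup (upper_central G n).
Proof.
elim: n => [|n IH].
  split=> //= [x y -> ->|x ->|x y ->]; first by rewrite mulg1.
    by rewrite invg1.
  by rewrite conj1g.
split=> /= [y|x y ux uy z|x ux z|x y ux z].
- by rewrite comm1g; exact: normal1.
- have -> : [~ x * y, z]%g = ([~ x, z] ^ y * [~ y, z])%g.
    by rewrite /commg /conjg invgM !mulgA !mulgK.
  exact: (normalM IH) (normalJ IH _ (ux z)) (uy z).
- have -> : [~ x^-1, z]%g = ([~ x, z]^-1 ^ x^-1)%g.
    by rewrite /commg /conjg !invgM !invgK !mulgA mulgK.
  exact: (normalJ IH) (normalV IH (ux z)).
- have -> : [~ x ^ y, z]%g = ([~ x, z ^ y^-1] ^ y)%g.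
    by rewrite conjRg -conjgM mulVg conjg1.
  exact: (normalJ IH).
Qed.

Lemma upper_centralS n : upper_central G n `<=` upper_central G n.+1.
Proof.
elim: n => [x -> y|n IH x ux y]; first by rewrite comm1g.
exact/IH/ux.
Qed.

Lemma upper_central_leq m n :
  (m <= n)%N -> upper_central G m `<=` upper_central G n.
Proof.
move=> /subnK <-; elim: (n - m)%N => // k IH x /IH; rewrite addSn.
exact: upper_centralS.
Qed.

Lemma upper_central_nilpotent :
  nilpotent_group G -> exists n, forall x, upper_central G n x.
Proof.
case=> n G1; exists n => x.
suff sub i : (i <= n)%N -> lower_central G (n - i) `<=` upper_central G i.
  by apply: (sub n) => //; rewrite subnn.
elim: i => [_|i IH ilt y]; first by rewrite subn0 G1.
move=> ny z; apply: IH; first exact: ltnW.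
by rewrite -subSS subSn //; apply: generated_mem; exists y, z.
Qed.

(* If [u = [x, y]] commutes with [x], then [x ^+ m = (x ^+ m) ^ y = x ^+ m * u ^+ m];
   this is applied with [y] running up the upper central series. *)
Lemma upper_central1_root n x m :
  torsion_free G -> (forall y, upper_central G n y) ->
  (0 < m)%N -> upper_central G 1 (x ^+ m)%g -> upper_central G 1 x.
Proof.
move=> Gtf Gn m0 xm y.
elim: n y {Gn}(Gn y) => [y /= ->|n IH y uy]; first exact: commg1.
apply: (Gtf _ _ m0).
have ux : upper_central G n [~ x, y]%g.
  by rewrite -invgR; exact: (normalV (upper_central_normal n)).
have /eqP/commgP xu := IH _ ux.
have /eqP/conjg_fixP := xm y.
rewrite conjXg (_ : (x ^ y)%g = (x * [~ x, y])%g); last by rewrite /commg mulVKg.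
rewrite expgMn; last exact: xu.
by rewrite -[RHS]mulg1 => /mulgI.
Qed.

End UpperCentral.

Section CentralQuotient.
Variable G : groupType.
Let nZ := upper_central_normal G 1.
Let Q : groupType := quotient_group nZ.
Let q : {ghom G -> Q} := qpi nZ.

Lemma upper_central_quotient n x : upper_central G n.+1 x -> upper_central Q n (q x).
Proof.
elim: n x => [x ux|n IH x ux y]; first exact/qpi_eq1.
by have [z <-] := qpi_surj y; rewrite -gmulfR; exact/IH/ux.
Qed.

(** Torsion in the quotient comes from elements with a central power, and such elements are
    themselves central. *)
Lemma torsion_free_quotient n : torsion_free G ->
  (forall y, upper_central G n y) -> torsion_free Q.
Proof.
move=> Gtf Gn y m m0; have [x <-] := qpi_surj y.
rewrite -[(_ ^+ m)%g](gmulfXn q) => /qpi_eq1 xm; apply/qpi_eq1.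
exact: upper_central1_root xm.
Qed.

End CentralQuotient.

(** Indices run opposite to those of the upper central series, so that deeper elements have a larger
    index and can carry a larger weight. *)
Record central_filtration (G : groupType) (D : nat -> set G) (c : nat) : Prop :=
  CentralFiltration {
    filtration0 : forall x, D 0%N x;
    filtration_last : forall x, D c x -> x = 1%g;
    filtration_normal : forall i, normal_subgroup (D i);
    filtration_leq : forall i j, (i <= j)%N -> D j `<=` D i;
    filtration_comm : forall i x y, D i x -> D i.+1 [~ x, y]%g
  }.

Lemma upper_central_filtration (G : groupType) c :
  (forall x, upper_central G c x) ->
  central_filtration (fun i => upper_central G (c - i)) c.
Proof.
move=> Gc; split.
- by move=> x; rewrite subn0.
- by move=> x; rewrite subnn.
- by move=> i; exact: upper_central_normal.
- by move=> i j ij; apply: upper_central_leq; lia.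
- move=> i x y; have [ic|ci] := ltnP i c.
    by rewrite -(subnSK ic) => ux; exact: ux y.
  have [-> ->] : (c - i = 0 /\ c - i.+1 = 0)%N by lia.
  by move=> /= ->; exact: comm1g.
Qed.

(** * Weighted polynomial functions on subgroups *)

Record subgroup (G : groupType) (H : set G) : Prop := Subgroup {
  subgroup1 : H 1%g;
  subgroupM : forall x y, H x -> H y -> H (x * y)%g;
  subgroupV : forall x, H x -> H (x^-1)%g
}.

Lemma normal_is_subgroup (G : groupType) (N : set G) : normal_subgroup N -> subgroup N.
Proof. by case. Qed.

Lemma subgroupX (G : groupType) (H : set G) x n : subgroup H -> H x -> H (x ^+ n)%g.
Proof.
move=> sH Hx; elim: n => [|n IH]; first exact: subgroup1.
by rewrite expgS; exact: subgroupM.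
Qed.

(* [wpoly D H n f]: [f] has weighted degree less than [n] on [H], an element of
   [D i] counting for [2 ^ i].  With these weights a commutator of elements of
   [D i] and [D j], which lies in [D (maxn i j).+1], counts for at least the sum
   of their weights. *)
Definition wpoly (G : groupType) (D : nat -> set G) (H : set G) (n : nat)
    (f : G -> rat) : Prop :=
  forall s : seq (nat * G), (forall p, p \in s -> H p.2 /\ D p.1 p.2) ->
    (n <= \sum_(p <- s) 2 ^ p.1)%N ->
    forall y, H y -> foldl (fun g p => ldiff p.2 g) f s y = 0.

Section WeightedPoly.
Variables (G : groupType) (D : nat -> set G) (c : nat).
Hypothesis Dfilt : central_filtration D c.
Implicit Types (H : set G) (f g : G -> rat) (x y t : G).

Lemma wpoly_leq H m n f : (m <= n)%N -> wpoly D H m f -> wpoly D H n f.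
Proof. by move=> mn Hf s sH ns; apply: Hf => //; exact: leq_trans ns. Qed.

Lemma wpoly_zero H f : subgroup H -> wpoly D H 0 f <-> forall x, H x -> f x = 0.
Proof.
move=> sH; split=> [Hf x Hx|]; first by apply: (Hf [::]) => // p.
move=> f0 s; elim: s f f0 => [|p s IH] f f0 sHD _ y Hy /=; first exact: f0.
have [Hp _] := sHD p (mem_head _ _).
apply: IH => // [x Hx|r rs]; last by apply: sHD; rewrite inE rs orbT.
by rewrite /ldiff !f0 ?subrr //; exact: subgroupM.
Qed.

(** The recursive form of the definition. For [n = 0] the empty list of differences also counts,
    hence the restriction on [n]. *)
Lemma wpolyP H n f : (0 < n)%N -> wpoly D H n f <->
  forall i x, H x -> D i x -> wpoly D H (n - 2 ^ i) (ldiff x f).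
Proof.
move=> n0; split=> Hf.
  move=> i x Hx Dx s sHD ns y Hy; apply: (Hf ((i, x) :: s)) => //.
    by move=> p; rewrite inE => /predU1P[->|/sHD].
  by rewrite big_cons /= -leq_subLR.
case=> [|p s] sHD; first by rewrite big_nil; lia.
rewrite big_cons => ns y Hy /=.
have [Hp Dp] := sHD p (mem_head _ _).
apply: (Hf _ _ Hp Dp) => // [r rs|]; last by rewrite leq_subLR.
by apply: sHD; rewrite inE rs orbT.
Qed.

Lemma wpoly_ldiff H n f i x :
  subgroup H -> wpoly D H n f -> H x -> D i x -> wpoly D H (n - 2 ^ i) (ldiff x f).
Proof.
move=> sH Hf Hx Dx; case: (posnP n) Hf => [->|n0] Hf; last exact: (wpolyP _ _ n0).1.
move/(wpoly_zero _ sH): Hf => f0; rewrite sub0n; apply/wpoly_zero => // y Hy.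
by rewrite /ldiff !f0 ?subrr //; exact: subgroupM.
Qed.

Lemma wpolyD H n f g : subgroup H ->
  wpoly D H n f -> wpoly D H n g -> wpoly D H n (fun x => f x + g x).
Proof.
move=> sH; elim/ltn_ind: n f g => n IH f g; case: (posnP n) => [->|n0] Hf Hg.
  move/(wpoly_zero _ sH): Hf => f0; move/(wpoly_zero _ sH): Hg => g0.
  by apply/wpoly_zero => // x Hx; rewrite f0 ?g0 ?addr0.
apply/wpolyP => // i x Hx Dx.
rewrite (_ : ldiff _ _ = fun y => ldiff x f y + ldiff x g y); last first.
  by apply/funext => y; rewrite /ldiff; ring.
by apply: IH; [have := expn_gt0 2 i; lia|exact: wpoly_ldiff|exact: wpoly_ldiff].
Qed.

Lemma wpolyZ H n f a : subgroup H -> wpoly D H n f -> wpoly D H n (fun x => a * f x).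
Proof.
move=> sH; elim/ltn_ind: n f => n IH f; case: (posnP n) => [->|n0] Hf.
  move/(wpoly_zero _ sH): Hf => f0.
  by apply/wpoly_zero => // x Hx; rewrite f0 ?mulr0.
apply/wpolyP => // i x Hx Dx.
rewrite (_ : ldiff _ _ = fun y => a * ldiff x f y); last first.
  by apply/funext => y; rewrite /ldiff; ring.
by apply: IH; [have := expn_gt0 2 i; lia|exact: wpoly_ldiff].
Qed.

Lemma eq_wpoly H n f g :
  subgroup H -> (forall x, H x -> f x = g x) -> wpoly D H n f -> wpoly D H n g.
Proof.
move=> sH fg Hf.
have /(wpoly_leq (leq0n n)) Hd : wpoly D H 0 (fun x => g x - f x).
  by apply/wpoly_zero => // x Hx; rewrite fg ?subrr.
have := wpolyD sH Hf Hd; rewrite (_ : (fun _ => _) = g) //.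
by apply/funext => x; rewrite addrC subrK.
Qed.

Lemma wpoly_ltrans H n f x :
  subgroup H -> H x -> wpoly D H n f -> wpoly D H n (fun y => f (x * y)%g).
Proof.
move=> sH Hx Hf; rewrite (_ : (fun _ => _) = fun y => ldiff x f y + f y).
  apply: wpolyD => //; apply: wpoly_leq (wpoly_ldiff sH Hf Hx (filtration0 Dfilt x)).
  exact: leq_subr.
by apply/funext => y; rewrite /ldiff subrK.
Qed.

Lemma wpoly_rdiff H n f i x : subgroup H -> wpoly D H n f -> H x -> D i x ->
  wpoly D H (n - 2 ^ i) (fun y => f (y * x)%g - f y).
Proof.
move=> sH Hf Hx Dx; elim/ltn_ind: n f Hf => n IH f Hf.
have [ni|ni] := leqP n (2 ^ i).
  (* Here [y * x = x ^ y^-1 * y], and a left difference along this conjugate, still in [D i],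
     already kills [f]. *)
  rewrite (_ : n - 2 ^ i = 0)%N; last by lia.
  apply/wpoly_zero => // y Hy.
  have Dxy : D i (x ^ y^-1)%g by exact: (normalJ (filtration_normal Dfilt i)).
  have Hxy : H (x ^ y^-1)%g.
    by rewrite /conjg invgK; apply: subgroupM; last apply: subgroupM;
       rewrite //; exact: subgroupV.
  have := wpoly_ldiff sH Hf Hxy Dxy.
  rewrite (_ : n - 2 ^ i = 0)%N; last by lia.
  by move/(wpoly_zero _ sH) => /(_ _ Hy); rewrite /ldiff /conjg invgK !mulgA mulgVK.
apply/wpolyP => [|j z Hz Dz]; first by lia.
rewrite (_ : ldiff _ _ = fun y => ldiff z f (y * x)%g - ldiff z f y).
  rewrite -subnDA addnC subnDA; apply: IH; last exact: wpoly_ldiff.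
  by have := expn_gt0 2 j; lia.
by apply/funext => y; rewrite /ldiff !mulgA; ring.
Qed.

Lemma wpoly_rtrans H n f x :
  subgroup H -> H x -> wpoly D H n f -> wpoly D H n (fun y => f (y * x)%g).
Proof.
move=> sH Hx Hf; rewrite (_ : (fun _ => _) = fun y => (f (y * x)%g - f y) + f y).
  apply: wpolyD => //; apply: wpoly_leq (wpoly_rdiff sH Hf Hx (filtration0 Dfilt x)).
  exact: leq_subr.
by apply/funext => y; rewrite subrK.
Qed.

Lemma wpoly_conj H n f t : subgroup H -> (forall y, H y -> H (y ^ t)%g) ->
  wpoly D H n f -> wpoly D H n (fun y => f (y ^ t)%g).
Proof.
move=> sH Ht; elim/ltn_ind: n f => n IH f; case: (posnP n) => [->|n0] Hf.
  move/(wpoly_zero _ sH): Hf => f0.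
  by apply/wpoly_zero => // x Hx; rewrite f0 //; exact: Ht.
apply/wpolyP => // i x Hx Dx.
rewrite (_ : ldiff _ _ = fun y => ldiff (x ^ t)%g f (y ^ t)%g).
  apply: IH; first by have := expn_gt0 2 i; lia.
  apply: wpoly_ldiff => //; first exact: Ht.
  exact: (normalJ (filtration_normal Dfilt i)).
by apply/funext => y; rewrite /ldiff conjMg.
Qed.

(** Conjugation of [y] by [t] is left multiplication by [u y], and [u] maps [D j] into
    [D (maxn i j).+1]. The weight there is at least [2 ^ i + 2 ^ j], which pays for exchanging the
    conjugation with a difference along an element of [D j]. *)
Lemma wpoly_conjdiff H n f i t : subgroup H -> (forall y, H y -> H (y ^ t)%g) ->
  D i t -> wpoly D H n f -> wpoly D H (n - 2 ^ i) (fun y => f (y ^ t)%g - f y).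
Proof.
move=> sH Ht Dt; elim/ltn_ind: n f => n IH f Hf.
pose u x := (x ^ t * x^-1)%g.
have uK x : (u x * x)%g = (x ^ t)%g by rewrite mulgVK.
have Hu x : H x -> H (u x) by move=> Hx; apply: subgroupM (Ht _ Hx) (subgroupV sH Hx).
have uR x : u x = ([~ x, t] ^ x^-1)%g by rewrite /u /commg /conjg invgK !mulgA mulgV mul1g.
have Du j x : D j x -> D (maxn i j).+1 (u x).
  move=> Dx; rewrite uR; apply: (normalJ (filtration_normal Dfilt _)).
  rewrite /maxn; case: ifP => _; first exact: (filtration_comm Dfilt).
  rewrite -invgR; apply: (normalV (filtration_normal Dfilt _)).
  exact: (filtration_comm Dfilt).
have [ni|ni] := leqP n (2 ^ i).
  rewrite (_ : n - 2 ^ i = 0)%N; last by lia.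
  apply/wpoly_zero => // y Hy.
  have := wpoly_ldiff sH Hf (Hu _ Hy) (Du 0%N y (filtration0 Dfilt y)).
  rewrite maxn0 expnS (_ : n - _ = 0)%N; last by lia.
  by move/(wpoly_zero _ sH) => /(_ _ Hy); rewrite /ldiff uK.
apply/wpolyP => [|j x Hx Dx]; first by lia.
rewrite (_ : ldiff _ _ = fun y =>
  ldiff (u x) f (x * y ^ t)%g + (ldiff x f (y ^ t)%g - ldiff x f y)).
  apply: wpolyD => //.
    apply: (@wpoly_conj _ _ (fun y => ldiff (u x) f (x * y)%g)) => //.
    apply: wpoly_ltrans => //.
    apply: wpoly_leq (wpoly_ldiff sH Hf (Hu _ Hx) (Du _ _ Dx)).
    have := leq_pexp2l (isT : 0 < 2)%N (leq_maxl i j).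
    have := leq_pexp2l (isT : 0 < 2)%N (leq_maxr i j).
    by rewrite expnS; lia.
  rewrite -subnDA addnC subnDA; apply: IH; last exact: wpoly_ldiff.
  by have := expn_gt0 2 j; lia.
by apply/funext => y; rewrite /ldiff conjMg (mulgA (u x)) uK; ring.
Qed.

(** Left translations by elements outside [H] induce affine maps of this form on [H], once coset
    representatives are split off. *)
Lemma wpoly_conjdiff_mul H n f i k t :
  subgroup H -> (forall y, H y -> H (y ^ t)%g) -> H k -> D i k -> D i t ->
  wpoly D H n f -> wpoly D H (n - 2 ^ i) (fun y => f (k * y ^ t)%g - f y).
Proof.
move=> sH Ht Hk Dk Dt Hf; rewrite (_ : (fun _ => _) =
  fun y => ldiff k f (y ^ t)%g + (f (y ^ t)%g - f y)); last first.
  by apply/funext => y; rewrite /ldiff; ring.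
by apply: wpolyD => //; [apply: wpoly_conj => //; exact: wpoly_ldiff|exact: wpoly_conjdiff].
Qed.

Lemma wpoly_polyfun n f : wpoly D setT n f -> polyfun n f.
Proof.
have sT : subgroup [set: G] by split.
elim: n f => [f /(wpoly_zero _ sT) f0 x|n IH f Hf x]; first exact: f0.
apply: IH; have := wpoly_ldiff sT Hf (x := x) I (filtration0 Dfilt x).
by rewrite expn0 subn1.
Qed.

(** A difference along an element other than [1] weighs at most [2 ^ c], so a total weight of
    [n * 2 ^ c] takes at least [n] of them. *)
Lemma polyfun_wpoly H n f : subgroup H -> polyfun n f -> wpoly D H (n * 2 ^ c) f.
Proof.
move=> sH; elim: n f => [f f0|n IH f Hf]; first by apply/wpoly_zero.
apply/wpolyP => [|i x Hx Dx]; first by rewrite muln_gt0 expn_gt0.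
have [ic|ci] := leqP i c.
  apply: wpoly_leq (IH _ (Hf x)); rewrite mulSn.
  by have := leq_pexp2l (isT : 0 < 2)%N ic; lia.
have -> : x = 1%g by exact: (filtration_last Dfilt) (filtration_leq Dfilt (ltnW ci) Dx).
apply: (wpoly_leq (leq0n _)); apply/wpoly_zero => // y Hy.
by rewrite /ldiff mul1g subrr.
Qed.

(* [Ext] extends functions from [H] to [T]. *)
Lemma wpoly_extension H T N (Ext : (G -> rat) -> G -> rat) :
  subgroup H -> subgroup T ->
  (forall f, (forall x, H x -> f x = 0) -> forall x, T x -> Ext f x = 0) ->
  (forall n f i x, (n <= N)%N -> wpoly D H n f -> T x -> D i x ->
    exists2 g, wpoly D H (n - 2 ^ i) g &
      forall y, T y -> Ext f (x * y)%g - Ext f y = Ext g y) ->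
  forall n f, (n <= N)%N -> wpoly D H n f -> wpoly D T n (Ext f).
Proof.
move=> sH sT Ext0 ExtD; elim/ltn_ind => n IH f nN Hf.
case: (posnP n) Hf => [->|n0] Hf.
  by move/(wpoly_zero _ sH): Hf => f0; apply/wpoly_zero => //; exact: Ext0.
apply/wpolyP => // i x Tx Dx; have [g Hg xg] := ExtD _ _ _ _ nN Hf Tx Dx.
apply: (@eq_wpoly _ _ (Ext g)) => // [y Ty|]; first by rewrite -xg.
by apply: IH => //; have := expn_gt0 2 i; lia.
Qed.

End WeightedPoly.

(** * Polynomials in a right translation *)

(* Hensel lifting of the root [1] modulo powers of ['X - 1]. *)
Lemma polyX_root_mod m N : (0 < m)%N -> exists s : {poly rat},
  s.[1] = 1 /\ exists q, s ^+ m = 'X + q * ('X - 1%:P) ^+ N.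
Proof.
move=> m0; have mr0 : m%:R != 0 :> rat by rewrite Num.Theory.pnatr_eq0 -lt0n.
have Xroot (p : {poly rat}) : p.[1] = 0 -> exists q, p = q * ('X - 1%:P).
  by move=> p1; apply/factor_theorem/rootP.
case: N => [|N].
  exists 1; rewrite hornerC; split=> //; exists (1 - 'X).
  by rewrite expr0 mulr1 expr1n addrC subrK.
elim: N => [|N [s [s1 [q sm]]]].
  exists 1; rewrite hornerC; split=> //; exists (-1).
  by rewrite expr1n expr1; ring.
(* Since [(s + e) ^+ m - s ^+ m = e * S] with [S.[1] = m], this [a] makes [a * S + q] vanish at [1],
   which yields one more factor ['X - 1]. *)
pose a := - q.[1] / m%:R.
pose e : {poly rat} := a%:P * ('X - 1%:P) ^+ N.+1.
have e1 : e.[1] = 0 by rewrite /e !hornerE subrr expr0n mulr0.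
exists (s + e); rewrite hornerD s1 e1 addr0; split=> //.
pose S := \sum_(i < m) (s + e) ^+ (m.-1 - i) * s ^+ i.
have S1 : S.[1] = m%:R.
  rewrite /S horner_sum (eq_bigr (fun=> 1)) ?sumr_const ?card_ord // => i _.
  by rewrite hornerM !horner_exp hornerD s1 e1 addr0 !expr1n mulr1.
have [|r Er] := Xroot (a%:P * S + q).
  by rewrite hornerD hornerM hornerC S1 /a mulfVK // addNr.
exists r; rewrite exprS mulrA -Er.
have := subrXX (s + e) s m.
rewrite (_ : \sum_(i < m) _ = S) // => /eqP; rewrite subr_eq => /eqP ->.
by rewrite sm addrAC subrr add0r /e; ring.
Qed.

Section RightPoly.
Variables (G : groupType) (z : G).
Implicit Types (p q : {poly rat}) (f g : G -> rat).

(* [p] evaluated at the right translation by [z]. *)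
Definition rpoly p f : G -> rat := fun y => \sum_(k < size p) p`_k * f (y * z ^+ k)%g.

Lemma rpoly_widen n p f y : (size p <= n)%N ->
  rpoly p f y = \sum_(k < n) p`_k * f (y * z ^+ k)%g.
Proof.
move=> pn; rewrite /rpoly (big_ord_widen n (fun k => p`_k * f (y * z ^+ k)%g)) //.
rewrite big_mkcond; apply: eq_bigr => k _; case: ifP => // /negbT.
by rewrite -leqNgt => /(nth_default 0) ->; rewrite mul0r.
Qed.

Lemma rpolyD p q f y : rpoly (p + q) f y = rpoly p f y + rpoly q f y.
Proof.
pose n := maxn (size p) (size q).
rewrite !(@rpoly_widen n) ?leq_maxl ?leq_maxr ?size_polyD // -big_split.
by apply: eq_bigr => k _; rewrite coefD mulrDl.
Qed.

Lemma rpolyC a f y : rpoly a%:P f y = a * f y.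
Proof.
by rewrite (@rpoly_widen 1) ?size_polyC ?leq_b1 // big_ord1 coefC mulg1.
Qed.

Lemma rpolyMX p f y : rpoly (p * 'X) f y = rpoly p f (y * z)%g.
Proof.
rewrite (@rpoly_widen (size p).+1) ?size_polyMXn //; last first.
  by rewrite (leq_trans (size_polyMleq _ _)) // size_polyX addn2.
rewrite big_ord_recl coefMX mul0r add0r; apply: eq_bigr => k _.
by rewrite coefMX /= -mulgA -expgS.
Qed.

Lemma rpolyZ a p f y : rpoly (a%:P * p) f y = a * rpoly p f y.
Proof.
rewrite (@rpoly_widen (size p)); last by rewrite mul_polyC size_scale_leq.
by rewrite mulr_sumr; apply: eq_bigr => k _; rewrite coefCM mulrA.
Qed.

Lemma rpolyM p q f y : rpoly (p * q) f y = rpoly p (rpoly q f) y.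
Proof.
elim/poly.poly_ind: p y => [|p a IH] y; first by rewrite mul0r /rpoly size_poly0 !big_ord0.
by rewrite mulrDl !rpolyD rpolyMX rpolyC rpolyZ mulrAC rpolyMX IH.
Qed.

Lemma rpoly1 f y : rpoly 1 f y = f y.
Proof. by rewrite -polyC1 rpolyC mul1r. Qed.

Lemma rpoly_sub p f g y : rpoly p (fun x => f x - g x) y = rpoly p f y - rpoly p g y.
Proof. by rewrite /rpoly -sumrB; apply: eq_bigr => k _; rewrite mulrBr. Qed.

Variables (D : nat -> set G) (c : nat) (H : set G).
Hypotheses (Dfilt : central_filtration D c) (sH : subgroup H) (Hz : H z).

Lemma wpoly_rpoly n p f : wpoly D H n f -> wpoly D H n (rpoly p f).
Proof.
move=> Hf; elim/poly.poly_ind: p => [|p a IH].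
  apply: (wpoly_leq (leq0n n)); apply/wpoly_zero => // x _.
  by rewrite /rpoly size_poly0 big_ord0.
rewrite (_ : rpoly _ _ = fun y => rpoly p f (y * z)%g + a * f y); last first.
  by apply/funext => y; rewrite rpolyD rpolyMX rpolyC.
apply: (wpolyD sH); last exact: wpolyZ.
exact: (wpoly_rtrans Dfilt).
Qed.

(** The factor ['X - 1] of [p] acts as the right difference along [z]. *)
Lemma wpoly_rpoly_root i n p f : D i z -> p.[1] = 0 ->
  wpoly D H n f -> wpoly D H (n - 2 ^ i) (rpoly p f).
Proof.
move=> Dz /rootP/factor_theorem[q ->] /(wpoly_rpoly q) Hf.
rewrite mulrC (_ : rpoly _ _ = fun y => rpoly q f (y * z)%g - rpoly q f y).
  exact: (wpoly_rdiff Dfilt).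
apply/funext => y.
by rewrite mulrBl rpolyD mulrC rpolyMX -mulNr -polyCN rpolyZ mulN1r.
Qed.

(** Each factor ['X - 1] costs at least one degree, so on [H] the polynomial matters only modulo the
    [n]-th power of ['X - 1]. *)
Lemma rpoly_pow_root n p q f y : wpoly D H n f -> H y ->
  rpoly (p + q * ('X - 1%:P) ^+ n) f y = rpoly p f y.
Proof.
move=> Hf Hy; rewrite rpolyD; suff: wpoly D H 0 (rpoly (q * ('X - 1%:P) ^+ n) f).
  by move/(wpoly_zero _ _ sH) => /(_ _ Hy) ->; rewrite addr0.
rewrite (_ : rpoly _ _ = rpoly q (rpoly (('X - 1%:P) ^+ n) f)); last first.
  by apply/funext => x; exact: rpolyM.
apply: wpoly_rpoly; rewrite -[X in wpoly _ _ X](subnn n).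
suff: forall k, wpoly D H (n - k) (rpoly (('X - 1%:P) ^+ k) f) by [].
elim=> [|k IH].
  rewrite subn0 (_ : rpoly _ _ = f) //.
  by apply/funext => x; rewrite rpoly1.
rewrite subnS -subn1 exprS.
rewrite (_ : rpoly _ _ = rpoly ('X - 1%:P) (rpoly (('X - 1%:P) ^+ k) f)).
  apply: (@wpoly_rpoly_root 0) => //; first exact: (filtration0 Dfilt).
  by rewrite !hornerE subrr.
by apply/funext => x; exact: rpolyM.
Qed.

End RightPoly.

(** * Extension to a cyclic overgroup *)

(** The integer powers of [t], written with natural exponents only. *)
Definition cyclic_set (G : groupType) (t : G) : set G :=
  [set z | exists m n : nat, z = (t ^+ m * t ^- n)%g].

Lemma cyclic_set_subgroup (G : groupType) (t : G) : subgroup (cyclic_set t).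
Proof.
split=> [|_ _ [m [n ->]] [m' [n' ->]]|_ [m [n ->]]].
- by exists 0%N, 0%N; rewrite mulgV.
- exists (m + m')%N, (n' + n)%N; rewrite !expgnDr invgM !mulgA.
  congr (_ * _)%g; rewrite -!mulgA; congr (_ * _)%g.
  exact/esym/commuteV/commuteX/commute_sym/commuteX.
- by exists n, m; rewrite invgM invgK.
Qed.

Section CyclicExtension.
Variables (G : groupType) (D : nat -> set G) (c : nat).
Hypothesis Dfilt : central_filtration D c.
Variables (H : set G) (t : G) (i : nat).
Hypotheses (sH : subgroup H) (Dt : D i t) (DH : D i.+1 `<=` H) (HD : H `<=` D i).

Definition cyclic_extension : set G :=
  [set x | exists2 z, cyclic_set t z & H (x * z^-1)%g].
Local Notation T := cyclic_extension.

Let sC := cyclic_set_subgroup t.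
Let sD := normal_is_subgroup (filtration_normal Dfilt i).

(** As [H] lies between consecutive terms of the filtration, commutators of its elements fall into
    [D i.+1], hence into [H]. *)
Lemma layer_normal y g : H y -> H (y ^ g)%g.
Proof.
move=> Hy; rewrite -(mulVKg y (y ^ g)%g) -commgEl; apply: (subgroupM sH) => //.
exact/DH/(filtration_comm Dfilt)/HD.
Qed.

Lemma cyclic_extension_subgroup : subgroup T.
Proof.
split=> [|x y [z Cz xz] [w Cw yw]|x [z Cz xz]].
- by exists 1%g; [exact: subgroup1 | rewrite mulgV; exact: subgroup1].
- exists (z * w)%g; first exact: subgroupM.
  rewrite (_ : x * y * _ = (x * z^-1) * (y * w^-1) ^ z^-1)%g.
    by apply: (subgroupM sH) => //; exact: layer_normal.
  by rewrite /conjg invgM invgK !mulgA mulgVK.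
- exists (z^-1)%g; first exact: subgroupV.
  rewrite (_ : x^-1 * _ = ((x * z^-1) ^ z)^-1)%g.
    exact/(subgroupV sH)/layer_normal.
  by rewrite /conjg !invgM !invgK !mulgA mulVg mul1g.
Qed.

Lemma sub_cyclic_extension : H `<=` T.
Proof.
by move=> x Hx; exists 1%g; [exact: subgroup1 | rewrite invg1 mulg1].
Qed.

Lemma cyclic_set_extension : cyclic_set t `<=` T.
Proof. by move=> z Cz; exists z => //; rewrite mulgV; exact: subgroup1. Qed.

Lemma cyclic_extension_layer : T `<=` D i.
Proof.
move=> x [z [m [n ->]] /HD xz]; rewrite -[x](mulgVK (t ^+ m * t ^- n)%g).
apply: (subgroupM sD xz); apply: (subgroupM sD); first exact: subgroupX.
by apply: (subgroupV sD); exact: subgroupX.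
Qed.

(** An element outside [H] is outside [D i.+1], so its weight is at most [2 ^ i]; differences that
    leave [H] therefore need only a loss of [2 ^ i]. *)
Lemma cyclic_extension_weight n j x f : T x -> D j x -> ~ H x ->
  wpoly D H (n - 2 ^ i) f -> wpoly D H (n - 2 ^ j) f.
Proof.
move=> Tx Dx nHx; apply: wpoly_leq; apply: leq_sub2l.
rewrite leq_exp2l //; rewrite leqNgt; apply/negP => ij; apply: nHx; apply: DH.
exact: (filtration_leq Dfilt ij).
Qed.

(** The overgroup is a semidirect product of [H] and the powers of [t]; the extension evaluates [f]
    at the [H]-component. *)
Lemma cyclic_extension_free N f : (forall j, (0 < j)%N -> ~ H (t ^+ j)%g) ->
  wpoly D H N f ->
  exists2 g, wpoly D T N g & forall x, H x -> g x = f x.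
Proof.
move=> tfree Hf.
have CH z : cyclic_set t z -> H z -> z = 1%g.
  case=> m [n ->]; wlog nm : m n / (n <= m)%N.
    move=> th; have [/th//|/ltnW/th mn] := leqP n m.
    move=> /(subgroupV sH); rewrite invgM invgK => /mn /(congr1 (fun u : G => u^-1%g)).
    by rewrite invgM invgK invg1.
  rewrite -expgnFr //; have [->|k0] := posnP (m - n)%N; first by rewrite expg0.
  by move=> Hk; case: (tfree _ k0 Hk).
(* On the overgroup the factorisation is unique, which determines [rho]; the default [1] matters
   only outside it. *)
pose rho x := xget 1%g [set z | cyclic_set t z /\ H (x * z^-1)%g].
have rhoE x z : cyclic_set t z -> H (x * z^-1)%g -> rho x = z.
  move=> Cz xz; have [Cr xr] : [set z | cyclic_set t z /\ H (x * z^-1)%g] (rho x).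
    by apply: (xgetPex 1%g); exists z.
  apply/esym/divg1_eq/CH; first exact: subgroupM (subgroupV _ _).
  have := subgroupM sH (subgroupV sH xz) xr; rewrite invgM invgK !mulgA mulgVK.
  exact.
exists (fun x => f (x * (rho x)^-1)%g); last first.
  by move=> x Hx; rewrite (rhoE _ 1%g) ?invg1 ?mulg1 //; exact: subgroup1.
move: (leqnn N) Hf; apply: (@wpoly_extension _ _ H T N
  (fun f x => f (x * (rho x)^-1)%g)) => //; first exact: cyclic_extension_subgroup.
  by move=> h h0 x [z Cz xz]; rewrite (rhoE _ z) ?h0.
move=> n h j x _ Hh Tx Dx; have [z Cz xz] := Tx.
exists (fun y => h (x * z^-1 * y ^ z^-1)%g - h y).
  have [Hx|nHx] := pselect (H x).
    have -> : z = 1%g by rewrite -(rhoE _ _ Cz xz) (rhoE _ 1%g) ?invg1 ?mulg1 //; exact: subgroup1.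
    rewrite invg1 mulg1 (_ : (fun _ => _) = ldiff x h); first exact: wpoly_ldiff.
    by apply/funext => y; rewrite conjg1.
  apply: (cyclic_extension_weight Tx Dx nHx).
  apply: (wpoly_conjdiff_mul Dfilt) => // [u Hu||]; [exact: layer_normal|exact: HD|].
  exact/(subgroupV sD)/cyclic_extension_layer/cyclic_set_extension.
move=> y [w Cw yw]; rewrite (rhoE y w) // (rhoE _ (z * w)%g).
- congr (h _ - _); rewrite /conjg invgM invgK !mulgA mulgVK //.
- exact: subgroupM.
- rewrite (_ : x * y * _ = (x * z^-1) * (y * w^-1) ^ z^-1)%g.
    by apply: (subgroupM sH) => //; exact: layer_normal.
  by rewrite /conjg invgM invgK !mulgA mulgVK.
Qed.

(* A root [s] of ['X ^+ m] modulo a power of ['X - 1] makes the right translation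
   by [z = t ^+ m], which is unipotent on functions of bounded degree, the [m]-th
   power of the operator [rpoly z s]; the latter serves as right translation
   by [t]. *)
Lemma cyclic_extension_torsion N f j0 : (0 < j0)%N -> H (t ^+ j0)%g ->
  wpoly D H N f ->
  exists2 g, wpoly D T N g & forall x, H x -> g x = f x.
Proof.
move=> j00 Hj0 Hf.
have exm : exists m, (0 < m)%N && `[< H (t ^+ m)%g >].
  by exists j0; rewrite j00; apply/asboolP.
case: (ex_minnP exm) => m /andP[m0 /asboolP Hm] minm.
have tH n : H (t ^+ n)%g -> exists q, n = (m * q)%N.
  move=> Hn; exists (n %/ m)%N; rewrite mulnC [LHS](divn_eq n m).
  have [->|r0] := posnP (n %% m)%N; first by rewrite addn0.
  have /minm : ((0 < n %% m) && `[< H (t ^+ (n %% m))%g >])%N.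
    rewrite r0; apply/asboolP.
    rewrite -[(_ ^+ _)%g](mulKg (t ^+ (m * (n %/ m)))%g) -expgnDr.
    rewrite mulnC -divn_eq; apply: (subgroupM sH) => //; apply: (subgroupV sH).
    by rewrite mulnC expgnA; exact: subgroupX.
  by rewrite leqNgt ltn_pmod.
pose z := (t ^+ m)%g.
have Dz : D i z by exact: HD.
have [s [s1 [q sm]]] := polyX_root_mod N m0.
have zC k l : commute (z ^+ k)%g (t ^+ l)%g.
  by rewrite /z -expgnA; exact/commuteX/commute_sym/commuteX/commute_refl.
(* Modulo a power of ['X - 1] that kills [h], the polynomial [s ^+ m] is ['X], the right translation
   by [z]. *)
have sX n h y k : (n <= N)%N -> wpoly D H n h -> H y ->
    rpoly z (s ^+ (m * k)) h y = h (y * z ^+ k)%g.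
  move=> nN /(wpoly_leq nN) {}Hh; elim: k y => [|k IH] y Hy.
    by rewrite muln0 rpoly1 mulg1.
  rewrite mulnS exprD sm.
  rewrite (_ : _ * _ = s ^+ (m * k) * 'X + q * s ^+ (m * k) * ('X - 1%:P) ^+ N).
    rewrite (rpoly_pow_root Dfilt sH Hm _ _ Hh) // rpolyMX IH.
      by rewrite -mulgA -expgS.
    exact: (subgroupM sH).
  by rewrite mulrDl mulrC; congr (_ + _); rewrite mulrAC.
(* Natural exponents suffice to represent all cosets of [H], because a positive power of [t] lies in
   [H]. *)
pose idx x := xget 0%N [set j : nat | H (x * t ^- j)%g].
pose Ext h x := rpoly z (s ^+ idx x) h (x * t ^- (idx x))%g.
(* Independence of the exponent: two admissible ones differ by some [m * l], and [s ^+ (m * l)]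
   makes up for the shift of the argument by [z ^+ l]. *)
have ExtE_ n h x j k : (n <= N)%N -> wpoly D H n h ->
    H (x * t ^- j)%g -> H (x * t ^- k)%g -> (j <= k)%N ->
    rpoly z (s ^+ j) h (x * t ^- j)%g = rpoly z (s ^+ k) h (x * t ^- k)%g.
  move=> nN Hh xj xk jk.
  have [l kj] : exists l, (k - j)%N = (m * l)%N.
    apply: tH; rewrite expgnFr //.
    have := subgroupM sH (subgroupV sH xk) xj.
    by rewrite invgM invgK !mulgA mulgVK.
  have Ek : k = (m * l + j)%N by rewrite -kj subnK.
  rewrite Ek exprD rpolyM (sX n) //; last 2 first.
  - exact: (wpoly_rpoly Dfilt).
  - by rewrite -Ek.
  congr rpoly; rewrite expgnDr invgM -!mulgA; congr (_ * _)%g.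
  by rewrite /z -expgnA mulVg mulg1.
have ExtE n h x j : (n <= N)%N -> wpoly D H n h -> H (x * t ^- j)%g ->
    Ext h x = rpoly z (s ^+ j) h (x * t ^- j)%g.
  move=> nN Hh xj.
  have xidx : [set j : nat | H (x * t ^- j)%g] (idx x) by apply: (xgetPex 0%N); exists j.
  rewrite /Ext; have [jk|/ltnW kj] := leqP j (idx x); last exact: (ExtE_ n).
  exact/esym/(ExtE_ n).
have TP x : T x -> exists j, H (x * t ^- j)%g.
  (* The summand [m * b] keeps the exponent nonnegative and does not change the coset, since
     [t ^+ m] is in [H]. *)
  case=> _ [a [b ->]] xab; exists (m * b + a - b)%N.
  have bm : (b <= m * b + a)%N by rewrite (leq_trans _ (leq_addr _ _)) ?leq_pmull.
  rewrite expgnFr // expgnDr -mulgA invgM mulgA.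
  apply: (subgroupM sH xab); apply: (subgroupV sH).
  by rewrite expgnA; exact: subgroupX.
exists (Ext f); last first.
  move=> x Hx; rewrite (ExtE N _ _ 0%N) ?invg1 ?mulg1 //.
  by rewrite rpoly1.
move: (leqnn N) Hf; apply: (@wpoly_extension _ _ H T N Ext) => //.
- exact: cyclic_extension_subgroup.
- move=> h h0 x /TP[j xj].
  have Hh : wpoly D H 0 h by apply/wpoly_zero.
  rewrite (ExtE 0%N _ _ j) //.
  by have /(wpoly_zero _ _ sH) -> := wpoly_rpoly Dfilt sH Hm (s ^+ j) Hh.
move=> n h l x nN Hh Tx Dx; have [a xa] := TP x Tx.
pose g y := rpoly z (s ^+ a) h (x * t ^- a * y ^ (t ^- a))%g - h y.
have Hg : wpoly D H (n - 2 ^ i) g.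
  (* Both parts lose [2 ^ i]: the first as an affine map with data in [D i], the second because
     [s ^+ a - 1] vanishes at [1]. *)
  rewrite (_ : g = fun y => (rpoly z (s ^+ a) h (x * t ^- a * y ^ (t ^- a))%g
    - rpoly z (s ^+ a) h y) + rpoly z (s ^+ a - 1) h y); last first.
    by apply/funext => y; rewrite rpolyD -polyCN rpolyC /g; ring.
  apply: (wpolyD sH).
    apply: (wpoly_conjdiff_mul Dfilt) => // [u Hu|||].
    - exact: layer_normal.
    - exact: HD.
    - by apply: (subgroupV sD); exact: subgroupX.
    - exact: (wpoly_rpoly Dfilt).
  by apply: (wpoly_rpoly_root Dfilt) => //; rewrite !hornerE s1 expr1n subrr.
exists g.
  have [Hx|nHx] := pselect (H x); last exact: (cyclic_extension_weight Tx Dx nHx Hg).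
  have [k ak] : exists k, a = (m * k)%N.
    apply: tH; rewrite -[(t ^+ a)%g]invgK; apply: (subgroupV sH).
    by rewrite -[X in H X](mulKg x); apply: (subgroupM sH) xa; exact: subgroupV.
  apply: (@eq_wpoly _ _ _ _ (ldiff x h)) => //; last exact: wpoly_ldiff.
  move=> y Hy; rewrite /g /ldiff ak (sX n) //; last first.
    rewrite -ak; apply: (subgroupM sH) => //; exact: layer_normal.
  congr (h _ - _); rewrite /z -expgnA /conjg invgK !mulgA mulgVK.
  by rewrite mulgVK.
move=> y Ty; have [b yb] := TP y Ty.
have gN : wpoly D H n g by apply: wpoly_leq Hg; exact: leq_subr.
rewrite (ExtE n g y b) // (ExtE n h y b) // (ExtE n h _ (a + b)%N) //; last first.
  rewrite (_ : x * y * _ = (x * t ^- a) * (y * t ^- b) ^ t ^- a)%g.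
    by apply: (subgroupM sH) => //; exact: layer_normal.
  by rewrite expgnDr /conjg invgM invgK !mulgA mulgVK.
rewrite rpoly_sub exprD mulrC rpolyM; congr (_ - _).
rewrite (_ : x * y * _ = (x * t ^- a) * (y * t ^- b) ^ t ^- a)%g; last first.
  by rewrite expgnDr /conjg invgM invgK !mulgA mulgVK.
apply: eq_bigr => k _; congr (_ * rpoly _ _ _ _).
rewrite [((_ * z ^+ k) ^ _)%g]conjMg [RHS]mulgA; congr (_ * _)%g.
by apply/esym/eqP; rewrite conjg_fix; apply/commgP/commuteV/zC.
Qed.

Lemma cyclic_extension_wpoly N f : wpoly D H N f ->
  exists2 g, wpoly D T N g & forall x, H x -> g x = f x.
Proof.
move=> Hf; have [[j j0 Hj]|nHj] := pselect (exists2 j, (0 < j)%N & H (t ^+ j)%g).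
  exact: cyclic_extension_torsion Hj Hf.
by apply: cyclic_extension_free => // j j0 Hj; apply: nHj; exists j.
Qed.

End CyclicExtension.

(** * Polynomial functions on torsion-free nilpotent groups *)

Section ZornExtension.
Variables (G : groupType) (D : nat -> set G) (c : nat).
Hypothesis Dfilt : central_filtration D c.
Variables (N : nat) (H0 : set G) (f0 : G -> rat).

(** Comparability with every [D i] puts a proper subgroup [H] between two consecutive terms, as the
    cyclic step requires. *)
Definition partial_wpoly (H : set G) (f : G -> rat) : Prop :=
  [/\ subgroup H, forall i, H `<=` D i \/ D i `<=` H, wpoly D H N f,
      H0 `<=` H & forall x, H0 x -> f x = f0 x].

Definition graph_on (H : set G) (f : G -> rat) : set (G * rat) :=
  [set p | H p.1 /\ p.2 = f p.1].

Definition partial_graph (X : set (G * rat)) : Prop :=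
  X = set0 \/ exists H f, partial_wpoly H f /\ X = graph_on H f.

(** Each instance of the group laws and of the degree condition involves finitely many elements,
    which all lie in one member of the chain. *)
Lemma partial_graph_bigcup (F : set (set (G * rat))) :
  F `<=` partial_graph -> total_on F subset ->
  partial_graph (\bigcup_(X in F) X).
Proof.
move=> FP Ftot; have [F0|nF0] := pselect (forall X, F X -> X = set0).
  by left; apply/seteqP; split=> // p [X FX]; rewrite (F0 _ FX).
pose good H f := partial_wpoly H f /\ F (graph_on H f).
have [H1 [f1 good1]] : exists H f, good H f.
  have [X] : exists X, ~ (F X -> X = set0) by exact/existsNP.
  move=> /not_implyP[FX Xn0]; have [//|[H [f [Hf XE]]]] := FP _ FX.
  by exists H, f; split=> //; rewrite -XE.
have good_total H f H' f' : good H f -> good H' f' ->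
    (H `<=` H' /\ forall x, H x -> f' x = f x) \/
    (H' `<=` H /\ forall x, H' x -> f x = f' x).
  move=> [_ FH] [_ FH']; case: (Ftot _ _ FH FH') => sub; [left|right].
    by split=> [x Hx|x Hx]; have [] := sub (x, f x) (conj Hx erefl).
  by split=> [x Hx|x Hx]; have [] := sub (x, f' x) (conj Hx erefl).
pose U x := exists H f, good H f /\ H x.
pose fU x := xget 0 [set v | exists H f, [/\ good H f, H x & v = f x]].
have fUE H f x : good H f -> H x -> fU x = f x.
  move=> gH Hx.
  have [H' [f' [gH' Hx' ->]]] :
    [set v | exists H f, [/\ good H f, H x & v = f x]] (fU x).
    by apply: (xgetPex 0); exists (f x), H, f.
  by case: (good_total _ _ _ _ gH gH') => -[_ ->].
have Useq (s : seq (nat * G)) : (forall p, p \in s -> U p.2) ->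
    exists H f, good H f /\ forall p, p \in s -> H p.2.
  elim: s => [_|p s IH sU]; first by exists H1, f1; split.
  have [|H [f [gH Hs]]] := IH; first by move=> r rs; apply: sU; rewrite inE rs orbT.
  have [H' [f' [gH' Hp]]] := sU _ (mem_head _ _).
  case: (good_total _ _ _ _ gH gH') => -[sub _].
    exists H', f'; split=> // r; rewrite inE => /predU1P[->//|/Hs].
    exact: sub.
  by exists H, f; split=> // r; rewrite inE => /predU1P[->|/Hs//]; exact: sub.
have U2 x y : U x -> U y -> exists H f, [/\ good H f, H x & H y].
  move=> Ux Uy; have [|H [f [gH Hxy]]] := Useq [:: (0%N, x); (0%N, y)].
    by move=> p; rewrite !inE => /orP[/eqP->|/eqP->].
  exists H, f; split=> //; first exact: (Hxy (0%N, x) (mem_head _ _)).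
  by apply: (Hxy (0%N, y)); rewrite !inE eqxx orbT.
right; exists (U : set G), fU; split; last first.
  apply/seteqP; split=> [[x v] [X FX Xxv]|[x v] [[H [f [gH Hx]]] /= ->]].
    have [XE|[H [f [Hf XE]]]] := FP _ FX; first by move: Xxv; rewrite XE.
    have gH : good H f by split=> //; rewrite -XE.
    move: Xxv; rewrite XE => -[/= Hx ->]; split=> /=; first by exists H, f.
    by rewrite (fUE H f).
  by exists (graph_on H f); [exact: gH.2 | split; rewrite //= (fUE H f)].
have [[sH1 _ _ H01 f01] _] := good1.
split.
- split=> [|x y Ux Uy|x [H [f [gH Hx]]]].
  + by exists H1, f1; split=> //; exact: subgroup1.
  + have [H [f [gH Hx Hy]]] := U2 _ _ Ux Uy.
    by exists H, f; split=> //; have [[sH _ _ _ _] _] := gH; exact: subgroupM.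
  + by exists H, f; split=> //; have [[sH _ _ _ _] _] := gH; exact: subgroupV.
- move=> i; have [UD|nUD] := pselect ((U : set G) `<=` D i); [by left|right].
  have [x /not_implyP[[H [f [gH Hx]]] nDx]] : exists x, ~ (U x -> D i x).
    exact/existsNP.
  have [[_ /(_ i)[HD|DH] _ _ _] _] := gH; first by case: nDx; exact: HD.
  by move=> y /DH Hy; exists H, f.
- move=> s sU ns y Uy.
  have [|H [f [gH Hs]]] := Useq ((0%N, y) :: s).
    by move=> p; rewrite inE => /predU1P[->//|/sU[]].
  have [[sH _ Hf _ _] _] := gH.
  apply: (@eq_wpoly _ D H N f fU sH _ Hf) => //.
  + by move=> x Hx; rewrite (fUE H f).
  + by move=> p ps; split; [apply: Hs; rewrite inE ps orbT|have [] := sU _ ps].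
  + exact: (Hs _ (mem_head _ _)).
- by move=> x Hx; exists H1, f1; split=> //; exact: H01.
- by move=> x Hx; rewrite (fUE H1 f1) //; [exact: f01|exact: H01].
Qed.

(** If a maximal [H] is proper, take the least index [i.+1] with [D i.+1] inside [H]. Comparability
    puts [H] inside [D i], and adjoining some [t] of [D i] outside [H] contradicts maximality. *)
Lemma wpoly_extend_full : partial_wpoly H0 f0 ->
  exists2 f, wpoly D setT N f & forall x, H0 x -> f x = f0 x.
Proof.
move=> part0; have [X [PX Xmax]] := Zorn_bigcup partial_graph_bigcup.
have graphP H f : partial_wpoly H f -> partial_graph (graph_on H f).
  by move=> Hf; right; exists H, f.
case: PX => [X0|[H [f [[sH HD Hf H0H f0E] XE]]]].
  case: (Xmax _ _ (graphP _ _ part0)); rewrite X0; split=> // sub.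
  have [sH0 _ _ _ _] := part0.
  by have := sub (1%g, f0 1%g) (conj (subgroup1 sH0) erefl).
suff HT : forall x, H x by exists f => //; rewrite (_ : setT = H) //; apply/seteqP; split.
apply: contrapT => /existsNP[x nHx].
have exD : exists i, `[< D i `<=` H >].
  exists c; apply/asboolP => y Dy; rewrite (filtration_last Dfilt Dy).
  exact: subgroup1.
case: (ex_minnP exD) => [[|i]] /asboolP DH mini.
  by apply/nHx/DH; exact: (filtration0 Dfilt).
have nDH : ~ (D i `<=` H) by move=> /asboolP/mini; rewrite ltnn.
have [HDi|//] := HD i.
have [t /not_implyP[Dt nHt]] : exists t, ~ (D i t -> H t) by exact/existsNP.
have [g Tg gf] := cyclic_extension_wpoly Dfilt sH Dt DH HDi Hf.
have HsubT := @sub_cyclic_extension _ H t.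
have Tt : cyclic_extension H t t.
  by apply: (cyclic_set_extension sH); exists 1%N, 0%N; rewrite expg1 divg1.
apply: (Xmax (graph_on (cyclic_extension H t) g)); last first.
  apply: graphP; split=> //; last by move=> y H0y; rewrite gf ?f0E //; exact: H0H.
  - exact: (cyclic_extension_subgroup Dfilt _ sH DH HDi).
  - move=> j; have [ji|ij] := leqP j i; [left|right].
      move=> y /(cyclic_extension_layer Dfilt Dt HDi).
      exact: (filtration_leq Dfilt).
    by move=> y /(filtration_leq Dfilt ij) /DH /HsubT.
  - by move=> y /H0H /HsubT.
rewrite XE; split=> [[y v] [/= Hy ->]|sub].
  by split; rewrite /= ?gf //; exact: HsubT.
by have [/= /nHt] := sub (t, g t) (conj Tt erefl).
Qed.

End ZornExtension.

(* Jennings' theorem, in the form that rational polynomial functions separate the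
   points of a torsion-free nilpotent group. *)
Lemma torsion_free_nilpotent_polyfun n (G : groupType) (k : G) :
  torsion_free G -> (forall x : G, upper_central G n x) -> k <> 1%g ->
  exists m (f : G -> rat), polyfun m f /\ f k <> f 1%g.
Proof.
elim: n G k => [|n IH] G k Gtf Gn k1; first by case: k1; exact: Gn.
pose nZ := upper_central_normal G 1.
(* A noncentral [k] survives in the quotient by the centre, to which the induction hypothesis
   applies. *)
have [Zk|nZk] := pselect (upper_central G 1 k); last first.
  have [|||m [f [Hf fk]]] := IH (quotient_group nZ) (qpi nZ k).
  - exact: torsion_free_quotient Gtf Gn.
  - by move=> y; have [x <-] := qpi_surj y; exact: upper_central_quotient.
  - by move/qpi_eq1.
  exists m, (f \o qpi nZ); split; first by apply: polyfun_comp => // x y; exact: gmulfM.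
  by rewrite /= (_ : qpi nZ 1%g = 1%g) //; exact: gmulf1.
pose D i := upper_central G (n.+1 - i).
have Dfilt : central_filtration D n.+1 by exact: upper_central_filtration.
have kinj a b : (k ^+ a = k ^+ b)%g -> a = b.
  wlog ab : a b / (a <= b)%N.
    move=> th; have [/th//|/ltnW/th ba] := leqP a b.
    by move=> /esym/ba.
  move=> kab; apply/eqP; rewrite eqn_leq ab leqNgt; apply/negP; rewrite -subn_gt0.
  by move=> ba; apply: k1; apply: (Gtf _ _ ba); rewrite expgnFr // kab mulgV.
(* The homomorphism sending [k] to [1], well defined on the powers of [k] because [k] has infinite
   order. *)
pose f0 x := xget 0 [set v : rat |
  exists a b : nat, (x * k ^+ b = k ^+ a)%g /\ v = a%:R - b%:R].
have f0E x a b : (x * k ^+ b = k ^+ a)%g -> f0 x = a%:R - b%:R.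
  move=> xab; have [a' [b' [xab' ->]]] : [set v : rat |
      exists a b : nat, (x * k ^+ b = k ^+ a)%g /\ v = a%:R - b%:R] (f0 x).
    by apply: (xgetPex 0); exists (a%:R - b%:R), a, b.
  have /kinj E : (k ^+ (a' + b) = k ^+ (a + b'))%g.
    by rewrite !expgnDr -xab -xab' -!mulgA -!expgnDr addnC.
  by have := congr1 (fun n => n%:R : rat) E; rewrite !natrD => {}E; lra.
have sC := cyclic_set_subgroup k.
have CP x : cyclic_set k x -> exists a b : nat, (x * k ^+ b = k ^+ a)%g.
  by case=> a [b ->]; exists a, b; rewrite mulgVK.
have f0M x y : cyclic_set k x -> cyclic_set k y -> f0 (x * y)%g = f0 x + f0 y.
  move=> /CP[a [b xab]] /CP[a' [b' xab']].
  rewrite (f0E _ _ _ xab) (f0E _ _ _ xab') (f0E _ (a + a')%N (b' + b)%N).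
    by rewrite !natrD; ring.
  rewrite expgnDr -mulgA (mulgA y) xab' -expgnDr addnC expgnDr mulgA xab.
  by rewrite -expgnDr.
have f01 : f0 1%g = 0 by rewrite (f0E _ 0%N 0%N) ?mulg1 // subrr.
have Zsub : cyclic_set k `<=` upper_central G 1.
  have sZ := normal_is_subgroup nZ.
  move=> _ [a [b ->]]; apply: (subgroupM sZ); first exact: (subgroupX _ sZ Zk).
  exact: (subgroupV sZ) (subgroupX _ sZ Zk).
(* Differences of a homomorphism are constants, which satisfy the bound [2 ^ n.+1]; the difference
   itself uses up at most as much again, whence the factor [2]. *)
have Hf0 : wpoly D (cyclic_set k) (2 * 2 ^ n.+1) f0.
  apply/wpolyP => [|i x Cx Dx]; first by rewrite muln_gt0 expn_gt0.
  apply: (@eq_wpoly _ _ _ _ (fun=> f0 x)) => //.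
    by move=> y Cy; rewrite /ldiff f0M // addrK.
  have [ni|ni] := leqP i n.+1.
    apply: wpoly_leq (polyfun_wpoly Dfilt sC (polyfun_cst _)).
    by have := leq_pexp2l (isT : 0 < 2)%N ni; lia.
  apply: (wpoly_leq (leq0n _)); apply/wpoly_zero => // y _.
  have -> // : x = 1%g.
  exact: (filtration_last Dfilt) (filtration_leq Dfilt (ltnW ni) Dx).
have Ck : cyclic_set k k by exists 1%N, 0%N; rewrite expg1 divg1.
have [|f Hf ff0] := @wpoly_extend_full _ D _ Dfilt (2 * 2 ^ n.+1) (cyclic_set k) f0.
  split=> // i; have [ni|ni] := leqP i n; [left|right].
    by move=> x /Zsub; apply: upper_central_leq; rewrite subn_gt0.
  move=> x; rewrite /D (_ : n.+1 - i = 0)%N; last by lia.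
  by move=> /= ->; exact: subgroup1.
exists (2 * 2 ^ n.+1)%N, f; split; first exact: (wpoly_polyfun Dfilt).
rewrite !ff0 //; last exact: subgroup1.
by rewrite f01 (f0E _ 1%N 0%N) ?expg0 ?expg1 ?mulg1 // subr0; apply/eqP.
Qed.

(** [Ext] evaluates at the component in the kernel [K]. A left translation of [A] acts on this
    component by a conjugation followed by a multiplication, which lowers the weighted degree on [K]
    by at least one. *)
Lemma retract_polyfun (A C : groupType) (iC : {ghom C -> A}) (r : {ghom A -> C})
    (k : A) :
  (forall x, r (iC x) = x) -> torsion_free A -> nilpotent_group A ->
  r k = 1%g -> k <> 1%g ->
  exists m (f : A -> rat), [/\ polyfun m f,
    forall y x, f (y * iC x)%g = f y & f k <> f 1%g].
Proof.
move=> riC Atf /upper_central_nilpotent[c Ac] rk k1.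
have [m [f [Hf fk]]] := torsion_free_nilpotent_polyfun Atf Ac k1.
pose D i := upper_central A (c - i).
have Dfilt : central_filtration D c by exact: upper_central_filtration.
pose K : set A := [set x | r x = 1%g].
have sK : subgroup K.
  rewrite /K; split=> /= [|x y rx ry|x rx]; first exact: gmulf1.
    by rewrite gmulfM rx ry mulg1.
  by rewrite gmulfV rx invg1.
have nK x y : K x -> K (x ^ y)%g by rewrite /K /= gmulfJ => ->; exact: conj1g.
pose Ext h x : rat := h (x * (iC (r x))^-1)%g.
have KE x : K (x * (iC (r x))^-1)%g by rewrite /K /= gmulfF riC mulgV.
have polyExt n h : wpoly D K n h -> polyfun n (Ext h).
  elim: n h => [h /(wpoly_zero _ _ sK) h0 x|n IH h Hh x]; first exact: h0.
  pose s := iC (r x).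
  rewrite (_ : ldiff _ _ = Ext (fun y => h (x * s^-1 * y ^ s^-1)%g - h y)).
    apply: IH; rewrite (_ : n = n.+1 - 2 ^ 0)%N; last by rewrite subn1.
    apply: (wpoly_conjdiff_mul Dfilt) => //; first by move=> y; exact: nK.
    - exact: (filtration0 Dfilt).
    - exact: (filtration0 Dfilt).
  apply/funext => y; rewrite /ldiff /Ext; congr (h _ - _).
  by rewrite !gmulfM invgM -/s /conjg invgK !mulgA mulgVK.
exists (m * 2 ^ c)%N, (Ext f); split; first exact/polyExt/polyfun_wpoly.
- by move=> y x; rewrite /Ext !gmulfM riC invgM !mulgA mulgK.
- by rewrite /Ext rk !gmulf1 invg1 !mulg1.
Qed.

(** * Iterated integrals on amalgams *)

(** The argument is not a homomorphism of the pair. After inverting the pair, a left translation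
    acts on [iC x * y^-1] from the left through [x] and from the right through [y]. *)
Lemma polyfun_divl (A C : groupType) (iC : {ghom C -> A}) n (f : A -> rat) :
  polyfun n f -> polyfun n (fun p : C * A => f ((iC p.1)^-1 * p.2)%g).
Proof.
move=> Hf; suff Hinv : polyfun n (fun p : C * A => f (iC p.1 * p.2^-1)%g).
  have := polyfun_inv Hinv; congr polyfun; apply/funext => -[x y] /=.
  by rewrite gmulfV invgK.
elim: n f Hf => [f f0 p|n IH f Hf [x y]]; first exact: f0.
pose g z := ldiff (iC x) f (z * y^-1)%g + (f (z * y^-1)%g - f z).
rewrite (_ : ldiff _ _ = fun p : C * A => g (iC p.1 * p.2^-1)%g).
  apply: IH; apply: polyfunD; first exact: (polyfun_rtrans (y^-1)%g (Hf (iC x))).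
  exact: polyfun_rdiff.
apply/funext => -[x' y'].
by rewrite /g /ldiff /= gmulfM invgM !mulgA; ring.
Qed.

Section Star.
Variables (A B C : groupType) (iA : {ghom C -> A}) (iB : {ghom C -> B}).
Variables (rA : {ghom A -> C}) (rB : {ghom B -> C}).
Hypothesis rBK : forall x, rB (iB x) = x.

Local Notation G := (amalgam iA iB).
Local Notation word := (seq (A + B)).
Local Notation pi := (amalgam_pi iA iB).
Local Notation inA := (amalgam_inl iA iB).
Local Notation inB := (amalgam_inr iA iB).

Variable gamma : {ghom G -> C}.
Hypotheses (gammaA : forall a, gamma (inA a) = rA a).
Hypotheses (gammaB : forall b, gamma (inB b) = rB b).

(** Letters generate, and the difference along a product is a translated difference along the first
    factor plus the difference along the second. *)
Lemma polyfun_amalgam n (F : G -> rat) :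
  (forall a, polyfun n (ldiff (inA a) F)) ->
  (forall b, polyfun n (ldiff (inB b) F)) -> polyfun n.+1 F.
Proof.
move=> FA FB x; have [u ->] := amalgam_pi_surj x; elim: u => [|l u IH].
  rewrite (_ : ldiff _ _ = fun=> 0); first exact: polyfun0.
  apply/funext => y; rewrite /ldiff (_ : pi [::] = 1%g) // mul1g subrr //.
have lP : polyfun n (ldiff (pi [:: l]) F) by case: l.
rewrite (_ : ldiff _ _ = fun y => ldiff (pi [:: l]) F (pi u * y)%g + ldiff (pi u) F y).
  by apply: polyfunD => //; exact: polyfun_ltrans.
apply/funext => y; rewrite /ldiff -cat1s -amalgam_pi_cat.
by rewrite [amalgam_mul _ _](_ : _ = pi [:: l] * pi u)%g // mulgA; ring.
Qed.

Variable f : G -> rat.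
Hypothesis fA : forall a w, f (inA a * w)%g = f w.

(* A discrete iterated integral: the sum, over the letters [a] from [A] of the
   word [u = u1 a u2], of [f (u2 q) * (h (p a) - h p)], where [p] is the image of
   [u1] in [A]. *)
Fixpoint star_sum (h : A -> rat) (u : word) (q : G) : rat :=
  match u with
  | [::] => 0
  | inl a :: u' =>
      f (pi u' * q)%g * (h a - h 1%g) + star_sum (fun y => h (a * y)%g) u' q
  | inr b :: u' => star_sum (fun y => h (iA (rB b) * y)%g) u' q
  end.

(** The retraction of the amalgam onto [A] that is [iA \o rB] on [B], computed on words. *)
Definition word_left (u : word) : A :=
  amalgam_word_lift (idfun : {ghom A -> A}) (iA \o rB : {ghom B -> A}) u.

Lemma word_left_eq u v : amalgam_eq iA iB u v -> word_left u = word_left v.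
Proof.
move=> uv.
have E := @amalgam_lift_pi _ _ _ iA iB A (idfun : {ghom A -> A}) (iA \o rB : {ghom B -> A}).
rewrite /word_left -!E; [|by move=> x /=; rewrite rBK..].
by congr amalgam_lift; apply/amalgam_piP.
Qed.

Lemma piM u v : pi (u ++ v) = (pi u * pi v)%g.
Proof. by rewrite -amalgam_pi_cat. Qed.

Lemma star_sum_cat h u v q : star_sum h (u ++ v) q =
  star_sum h u (pi v * q)%g + star_sum (fun y => h (word_left u * y)%g) v q.
Proof.
elim: u h => [|[a|b] u IH] h /=.
- rewrite add0r; congr star_sum; apply/funext => y.
  by rewrite /word_left /amalgam_word_lift big_nil mul1g.
- rewrite IH piM -mulgA addrA; congr (_ + _); congr star_sum.
  by apply/funext => y; rewrite /word_left /amalgam_word_lift big_cons mulgA.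
- rewrite IH; congr (_ + _); congr star_sum.
  by apply/funext => y; rewrite /word_left /amalgam_word_lift big_cons mulgA.
Qed.

(** Merging letters of [A] uses the left [A]-invariance of [f], and gluing uses the right
    [C]-invariance of [h]; letters of [B] contribute no summand. *)
Lemma star_sum_eq u v h q : amalgam_eq iA iB u v ->
  (forall y x, h (y * iA x)%g = h y) -> star_sum h u q = star_sum h v q.
Proof.
move=> uv; elim: uv h q => {u v} //.
- by move=> u v _ IH h q hC; rewrite IH.
- by move=> u v w _ IHu _ IHv h q hC; rewrite IHu ?IHv.
- move=> u u' v v' uu' IHu vv' IHv h q hC.
  rewrite !star_sum_cat IHu // (amalgam_piP _ _ v v').2 // IHv; last first.
    by move=> y x; rewrite mulgA hC.
  by rewrite (word_left_eq uu').
- by move=> h q hC /=; rewrite subrr mulr0 addr0.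
- move=> a a' h q hC /=.
  rewrite (_ : pi [:: inl a'] * q = inA a' * q)%g // fA mulg1 (_ : pi [::] = 1%g) //.
  by rewrite mul1g; ring.
- move=> x h q hC /=.
  by rewrite -[iA x]mul1g hC subrr mulr0 addr0.
Qed.

(** The dependence on [gamma w] leaves room to make the integral invariant under [B] from the
    left. *)
Definition star (Psi : C * A -> rat) (w : G) : rat :=
  star_sum (fun y => Psi (gamma w, y)) (projT1 (cid (amalgam_pi_surj w))) 1%g.

Definition right_invariant (Psi : C * A -> rat) : Prop :=
  forall c y x, Psi (c, y * iA x)%g = Psi (c, y).

Lemma right_invariant_ltrans Psi p :
  right_invariant Psi -> right_invariant (fun q => Psi (p * q)%g).
Proof.
case: p => c a PsiC c' y x.
by have := PsiC (c * c')%g (a * y)%g x; rewrite -mulgA.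
Qed.

Lemma star_pi Psi u : right_invariant Psi ->
  star Psi (pi u) = star_sum (fun y => Psi (gamma (pi u), y)) u 1%g.
Proof.
move=> PsiC; rewrite /star; case: cid => v /= uv.
by apply: star_sum_eq => //; exact/amalgam_piP.
Qed.

Lemma star_inl Psi a w : right_invariant Psi -> star Psi (inA a * w)%g =
  f w * (Psi (rA a * gamma w, a)%g - Psi (rA a * gamma w, 1)%g) +
  star (fun p => Psi ((rA a, a) * p)%g) w.
Proof.
move=> PsiC; have [u ->] := amalgam_pi_surj w; rewrite -[inA a]/(pi [:: inl a]).
have gE : gamma (pi (inl a :: u)) = (rA a * gamma (pi u))%g.
  by rewrite -cat1s piM gmulfM gammaA.
rewrite -piM !star_pi //= ?gE ?mulg1 //.
exact: right_invariant_ltrans.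
Qed.

Lemma star_inr Psi b w : right_invariant Psi -> star Psi (inB b * w)%g =
  star (fun p => Psi ((rB b, iA (rB b)) * p)%g) w.
Proof.
move=> PsiC; have [u ->] := amalgam_pi_surj w; rewrite -[inB b]/(pi [:: inr b]).
have gE : gamma (pi (inr b :: u)) = (rB b * gamma (pi u))%g.
  by rewrite -cat1s piM gmulfM gammaB.
rewrite -piM !star_pi //= ?gE //.
exact: right_invariant_ltrans.
Qed.

Lemma star_sub Psi Phi w : star (fun p => Psi p - Phi p) w = star Psi w - star Phi w.
Proof.
rewrite /star; move: (projT1 _) => u.
suff: forall h k, star_sum (fun y => h y - k y) u 1%g =
  star_sum h u 1%g - star_sum k u 1%g by move=> ->.
elim: u => [|[a|b] u IH] h k /=; first by rewrite subrr.
  by rewrite IH; ring.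
by rewrite IH.
Qed.

(** Differencing along a letter of [B] differences [Psi]; along a letter of [A] it also adds [f]
    times a difference of [Psi] pulled back by [gamma]. *)
Lemma polyfun_star m n Psi : polyfun m f -> polyfun n Psi ->
  right_invariant Psi -> polyfun (m + n) (star Psi).
Proof.
move=> Hf; elim: n Psi => [|n IH] Psi HPsi PsiC.
  rewrite (_ : star Psi = fun=> 0); first exact: polyfun0.
  apply/funext => w; rewrite /star; move: (projT1 _) => u.
  suff: forall h, (forall y, h y = 0) -> star_sum h u 1%g = 0 by apply=> y; exact: HPsi.
  elim: u => [//|[a|b] u IH] h h0 /=; last by apply: IH.
  by rewrite !h0 subrr mulr0 add0r; apply: IH.
have ldiffC x : right_invariant (ldiff x Psi).
  by move=> c y z; rewrite /ldiff PsiC; congr (_ - _); exact: right_invariant_ltrans.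
rewrite addnS; apply: polyfun_amalgam => [a|b].
- pose g c := ldiff (1, a)%g Psi (c, 1)%g.
  rewrite (_ : ldiff _ _ = fun w => f w * g (rA a * gamma w)%g
    + star (ldiff (rA a, a) Psi) w).
    apply: polyfunD; last exact: IH.
    apply: polyfunM => //.
    rewrite (_ : (fun w => g _) =
      (fun p => ldiff (1, a)%g Psi ((rA a, 1) * p)%g) \o (fun w => (gamma w, 1)%g)).
      apply: polyfun_comp; last exact/polyfun_ltrans/HPsi.
      by move=> x y; rewrite gmulfM; congr pair; rewrite mulg1.
    apply/funext => w; rewrite /g /=; congr (ldiff _ _ _).
    by congr pair; rewrite mulg1.
  apply/funext => w; rewrite {1}/ldiff star_inl // star_sub /g /ldiff.
  rewrite (_ : (1, a) * (rA a * gamma w, 1) = (rA a * gamma w, a))%g; first by ring.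
  by congr pair; [exact: mul1g|exact: mulg1].
- rewrite (_ : ldiff _ _ = star (ldiff (rB b, iA (rB b)) Psi)); first exact: IH.
  by apply/funext => w; rewrite {1}/ldiff star_inr // star_sub.
Qed.

(** Each summand contains the value of [f] at a proper suffix of [u]. *)
Lemma star_sum_vanish j h u : (forall v, (size v < j)%N -> f (pi v) = 0) ->
  (size u < j.+1)%N -> star_sum h u 1%g = 0.
Proof.
move=> f0; elim: u h => [//|[a|b] u IH] h /= uj; last exact/IH/ltnW.
by rewrite mulg1 f0 // mul0r add0r; exact/IH/ltnW.
Qed.

(** The function [psi (c^-1 * y)] does not change when a letter of [B] moves [c] and [y] by the same
    element of [C]. At [inA a * pi u] the summands from [u] vanish by length, and only that of the
    first letter remains. *)
Lemma star_exists m n (psi : A -> rat) : polyfun m f -> polyfun n psi ->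
  (forall y x, psi (y * iA x)%g = psi y) ->
  exists N (F : G -> rat), [/\ polyfun N F, forall b w, F (inB b * w)%g = F w &
    forall j, (forall u, (size u < j)%N -> f (pi u) = 0) ->
    (forall u, (size u < j.+1)%N -> F (pi u) = 0) /\
    forall a u, (size u < j.+1)%N -> gamma (inA a * pi u)%g = 1%g ->
      F (inA a * pi u)%g = f (pi u) * (psi a - psi 1%g)].
Proof.
move=> Hf Hpsi psiC; pose Psi (p : C * A) := psi ((iA p.1)^-1 * p.2)%g.
have PsiC : right_invariant Psi by move=> c y x; rewrite /Psi /= mulgA psiC.
exists (m + n)%N, (star Psi); split.
- by apply: polyfun_star => //; exact: polyfun_divl.
- move=> b w; rewrite star_inr //; congr (star _ w); apply/funext => -[c y].
  by rewrite /Psi /= gmulfM invgM !mulgA mulgVK.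
move=> j f0; split=> [u uj|a u uj]; first by rewrite star_pi // (star_sum_vanish _ f0).
rewrite gmulfM gammaA => g1; rewrite star_inl // g1 /Psi /= gmulf1 invg1 !mul1g.
rewrite star_pi ?(star_sum_vanish _ f0) ?addr0 //.
by move=> c y x /=; rewrite !mulgA psiC.
Qed.

End Star.

(** * Separation of reduced words *)

Definition swap_letter (A B : Type) (l : A + B) : B + A :=
  match l with inl a => inr a | inr b => inl b end.

Lemma map_swap_letterK (A B : Type) (u : seq (A + B)) :
  map (@swap_letter B A) (map (@swap_letter A B) u) = u.
Proof. by elim: u => //= -[a|b] u ->. Qed.

Section Swap.
Variables (A B C : groupType) (iA : {ghom C -> A}) (iB : {ghom C -> B}).

Lemma amalgam_eq_swap u v : amalgam_eq iA iB u v ->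
  amalgam_eq iB iA (map (@swap_letter A B) u) (map (@swap_letter A B) v).
Proof.
elim=> {u v} /=.
- by move=> u; exact: amalgam_refl.
- by move=> u v _; exact: amalgam_sym.
- by move=> u v w _ uv _; exact: amalgam_trans uv.
- by move=> u u' v v' _ uu' _ vv'; rewrite !map_cat; exact: amalgam_cat.
- exact: amalgam_1r.
- exact: amalgam_1l.
- by move=> a a'; exact: amalgam_Mr.
- by move=> b b'; exact: amalgam_Ml.
- by move=> c; exact/amalgam_sym/amalgam_glue.
Qed.

Definition swap (w : amalgam iA iB) : amalgam iB iA :=
  amalgam_pi iB iA (map (@swap_letter A B) (projT1 (cid (amalgam_pi_surj w)))).

Lemma swap_pi u :
  swap (amalgam_pi iA iB u) = amalgam_pi iB iA (map (@swap_letter A B) u).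
Proof.
rewrite /swap; case: cid => v /= uv; apply/amalgam_piP/amalgam_eq_swap.
exact/amalgam_piP.
Qed.

Fact swap_morph : monoid.monoid_morphism swap.
Proof.
split=> [|x y]; first exact: (swap_pi [::]).
have [u ->] := amalgam_pi_surj x; have [v ->] := amalgam_pi_surj y.
by rewrite -piM !swap_pi map_cat piM.
Qed.

HB.instance Definition _ :=
  isUMagmaMorphism.Build (amalgam iA iB) (amalgam iB iA) swap swap_morph.

End Swap.

Section Separation.
Variables (A B C : groupType) (iA : {ghom C -> A}) (iB : {ghom C -> B}).
Variables (rA : {ghom A -> C}) (rB : {ghom B -> C}).
Hypotheses (rAK : forall x, rA (iA x) = x) (rBK : forall x, rB (iB x) = x).

Local Notation G := (amalgam iA iB).
Local Notation word := (seq (A + B)).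
Local Notation pi := (amalgam_pi iA iB).
Local Notation inA := (amalgam_inl iA iB).
Local Notation inB := (amalgam_inr iA iB).

Local Notation swapAB := (@swap A B C iA iB).
Local Notation swapBA := (@swap B A C iB iA).

Variable gamma : {ghom G -> C}.
Hypotheses (gammaA : forall a, gamma (inA a) = rA a).
Hypotheses (gammaB : forall b, gamma (inB b) = rB b).

(** The construction for letters of [A], transported through [swap]. *)
Lemma star_exists_r m n (f : G -> rat) (psi : B -> rat) :
  (forall b w, f (inB b * w)%g = f w) -> polyfun m f -> polyfun n psi ->
  (forall y x, psi (y * iB x)%g = psi y) ->
  exists N (F : G -> rat), [/\ polyfun N F, forall a w, F (inA a * w)%g = F w &
    forall j, (forall u, (size u < j)%N -> f (pi u) = 0) ->
    (forall u, (size u < j.+1)%N -> F (pi u) = 0) /\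
    forall b u, (size u < j.+1)%N -> gamma (inB b * pi u)%g = 1%g ->
      F (inB b * pi u)%g = f (pi u) * (psi b - psi 1%g)].
Proof.
move=> fB Hf Hpsi psiC.
pose gamma' : {ghom amalgam iB iA -> C} := gamma \o swapBA.
have swapl b : swapBA (amalgam_inl iB iA b) = inB b by exact: (@swap_pi _ _ _ iB iA [:: inl b]).
have swapr a : swapBA (amalgam_inr iB iA a) = inA a by exact: (@swap_pi _ _ _ iB iA [:: inr a]).
have swapL b : swapAB (inB b) = amalgam_inl iB iA b by exact: (@swap_pi _ _ _ iA iB [:: inr b]).
have swapR a : swapAB (inA a) = amalgam_inr iB iA a by exact: (@swap_pi _ _ _ iA iB [:: inl a]).
have swapK w : swapBA (swapAB w) = w.
  by have [u ->] := amalgam_pi_surj w; rewrite !swap_pi map_swap_letterK.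
have [||||N [F [HF FA Fj]]] := @star_exists B A C iB iA rB rA rAK gamma'
    _ _ (f \o swapBA) _ m n psi _ Hpsi psiC.
- by move=> b; rewrite /= swapl.
- by move=> a; rewrite /= swapr.
- by move=> b w; rewrite /= gmulfM /= swapl fB.
- by apply: polyfun_comp => // x y; exact: gmulfM.
exists N, (F \o swapAB); split.
- by apply: polyfun_comp => // x y; exact: gmulfM.
- by move=> a w; rewrite /= gmulfM /= swapR FA.
move=> j f0; have [|F0 F1] := Fj j.
  by move=> u uj; rewrite /= swap_pi f0 // size_map.
split=> [u uj|b u uj gu]; first by rewrite /= swap_pi F0 // size_map.
rewrite /= gmulfM /= swapL swap_pi F1 ?size_map //=.
  by rewrite swap_pi map_swap_letterK.
by rewrite /= gmulfM /= swapl swap_pi map_swap_letterK.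
Qed.

Definition kernel_letter (l : A + B) : Prop :=
  match l with
  | inl a => rA a = 1%g /\ a <> 1%g
  | inr b => rB b = 1%g /\ b <> 1%g
  end.

(** Normal forms of the free product of the two kernels, without a factor from [C]. *)
Fixpoint reduced (s : word) : Prop :=
  if s is l :: s' then
    [/\ kernel_letter l, (if s' is l' :: _ then is_inl l != is_inl l' else true)
      & reduced s']
  else True.

Lemma reduced_gamma s : reduced s -> gamma (pi s) = 1%g.
Proof.
elim: s => [_|l s IH [lk _ /IH gs]]; first exact: gmulf1.
rewrite -cat1s piM gmulfM gs mulg1.
by case: l lk => [a|b] [r1 _]; [rewrite -r1; exact: gammaA|rewrite -r1; exact: gammaB].
Qed.

Hypotheses (A_tf : torsion_free A) (A_nil : nilpotent_group A).
Hypotheses (B_tf : torsion_free B) (B_nil : nilpotent_group B).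

(** The invariance clauses concern the factor not containing the first letter, from which the next
    letter is prepended; for the empty word the constant [1] satisfies both. *)
Lemma reduced_polyfun s : reduced s -> exists N (F : G -> rat), [/\ polyfun N F,
  forall u, (size u < size s)%N -> F (pi u) = 0, F (pi s) <> 0,
  (if s is inl _ :: _ then True else forall a w, F (inA a * w)%g = F w) &
  (if s is inr _ :: _ then True else forall b w, F (inB b * w)%g = F w)].
Proof.
elim: s => [_|l s IH]; first by exists 1%N, (fun=> 1); split=> //; exact: polyfun_cst.
move=> reds; have gs := reduced_gamma reds; move: reds.
move=> [lk alt reds]; have [m [f [Hf f0 fs fA fB]]] := IH reds.
case: l lk alt gs => [a|b] [r1 l1] alt gs.
- have {}fA x w : f (inA x * w)%g = f w by case: (s) alt fA => [|[]].
  have [n [psi [Hpsi psiC psia]]] := retract_polyfun rAK A_tf A_nil r1 l1.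
  have [N [F [HF FB Fj]]] := star_exists rBK gammaA gammaB fA Hf Hpsi psiC.
  have [F0 F1] := Fj _ f0.
  exists N, F; split=> //; rewrite -cat1s piM; rewrite -cat1s piM in gs.
  rewrite F1 //; apply/eqP; rewrite mulf_neq0 ?subr_eq0; exact/eqP.
- have {}fB x w : f (inB x * w)%g = f w by case: (s) alt fB => [|[]].
  have [n [psi [Hpsi psiC psib]]] := retract_polyfun rBK B_tf B_nil r1 l1.
  have [N [F [HF FA Fj]]] := star_exists_r fB Hf Hpsi psiC.
  have [F0 F1] := Fj _ f0.
  exists N, F; split=> //; rewrite -cat1s piM; rewrite -cat1s piM in gs.
  rewrite F1 //; apply/eqP; rewrite mulf_neq0 ?subr_eq0; exact/eqP.
Qed.

Definition letter_conj (c : C) (l : A + B) : A + B :=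
  match l with inl a => inl (a ^ iA c)%g | inr b => inr (b ^ iB c)%g end.

Lemma reduced_conj c s : reduced s -> reduced (map (letter_conj c) s).
Proof.
elim: s => //= l s IH [lk alt /IH reds]; split=> //.
  case: l lk {alt} => [a|b] /= [r1 l1]; split.
  - by rewrite gmulfJ r1 conj1g.
  - by move/eqP; rewrite conjg_eq1 => /eqP.
  - by rewrite gmulfJ r1 conj1g.
  - by move/eqP; rewrite conjg_eq1 => /eqP.
by case: s l alt {IH reds lk} => [|[] ? ?] [].
Qed.

Lemma pi_conj c s : (pi (map (letter_conj c) s) = pi s ^ inA (iA c))%g.
Proof.
elim: s => [|l s IH] /=; first by rewrite conj1g.
rewrite -cat1s -[in RHS]cat1s !piM conjMg IH; congr (_ * _)%g.
case: l => [a|b] /=; first exact: (gmulfJ (amalgam_inl iA iB : {ghom A -> G})).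
by rewrite amalgam_inl_inr; exact: (gmulfJ (amalgam_inr iA iB : {ghom B -> G})).
Qed.

Lemma reduced_cons_inl a s : rA a = 1%g -> reduced s ->
  exists2 s', reduced s' & (inA a * pi s)%g = pi s'.
Proof.
move=> ra reds; have [->|/eqP a1] := eqVneq a 1%g.
  by exists s => //; rewrite gmulf1 mul1g.
case: s reds => [_|[a'|b] s /= [lk alt reds]].
- by exists [:: inl a]; rewrite ?mulg1.
- have E : (inA a * pi (inl a' :: s) = inA (a * a') * pi s)%g.
    by rewrite -cat1s piM mulgA gmulfM.
  rewrite E; have [->|/eqP aa1] := eqVneq (a * a')%g 1%g.
    by exists s => //; rewrite gmulf1 mul1g.
  exists (inl (a * a')%g :: s); last by rewrite -[in RHS]cat1s piM.
  by split=> //; split=> //; rewrite gmulfM ra lk.1 mulg1.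
- exists (inl a :: inr b :: s); last by rewrite -[in RHS]cat1s piM.
  by split.
Qed.

Lemma reduced_cons_inr b s : rB b = 1%g -> reduced s ->
  exists2 s', reduced s' & (inB b * pi s)%g = pi s'.
Proof.
move=> rb reds; have [->|/eqP b1] := eqVneq b 1%g.
  by exists s => //; rewrite gmulf1 mul1g.
case: s reds => [_|[a|b'] s /= [lk alt reds]].
- by exists [:: inr b]; rewrite ?mulg1.
- exists (inr b :: inl a :: s); last by rewrite -[in RHS]cat1s piM.
  by split.
- have E : (inB b * pi (inr b' :: s) = inB (b * b') * pi s)%g.
    by rewrite -cat1s piM mulgA gmulfM.
  rewrite E; have [->|/eqP bb1] := eqVneq (b * b')%g 1%g.
    by exists s => //; rewrite gmulf1 mul1g.
  exists (inr (b * b')%g :: s); last by rewrite -[in RHS]cat1s piM.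
  by split=> //; split=> //; rewrite gmulfM rb lk.1 mulg1.
Qed.

(** Each letter is split into a kernel part and a part in [C]; the latter moves to the right end by
    conjugating the remaining letters. *)
Lemma reduced_form u : exists s c, reduced s /\ pi u = (pi s * inA (iA c))%g.
Proof.
elim: u => [|l u [s [c [reds us]]]].
  by exists [::], 1%g; split=> //; rewrite !gmulf1 mulg1.
have [x [s' [reds' Es']]] : exists x s', reduced s' /\
    (pi [:: l] * pi s = pi s' * inA (iA x))%g.
  case: l => [a|b].
  - have ra : rA (a * (iA (rA a))^-1)%g = 1%g by rewrite gmulfF rAK mulgV.
    have [s' reds' Es'] := reduced_cons_inl ra (reduced_conj (rA a)^-1 reds).
    exists (rA a), s'; split=> //; rewrite -Es' pi_conj !gmulfV /conjg invgK.
    by rewrite !gmulfM gmulfV !mulgA !mulgVK.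
  - have rb : rB (b * (iB (rB b))^-1)%g = 1%g by rewrite gmulfF rBK mulgV.
    have [s' reds' Es'] := reduced_cons_inr rb (reduced_conj (rB b)^-1 reds).
    exists (rB b), s'; split=> //; rewrite -Es' pi_conj !gmulfV /conjg invgK.
    by rewrite !gmulfM gmulfV /= -amalgam_inl_inr !mulgA !mulgVK.
exists s', (x * c)%g; split=> //.
by rewrite -cat1s piM us mulgA Es' -mulgA !gmulfM.
Qed.

Lemma amalgam_lower_central_separated (C_abelian : abelian_group C) (g : G) :
  g <> 1%g -> exists n, ~ lower_central G n g.
Proof.
have [u ->] := amalgam_pi_surj g; have [s [c [reds us]]] := reduced_form u.
have gc : gamma (pi u) = c by rewrite us gmulfM gammaA rAK reduced_gamma ?mul1g.
have [c1 u1|/eqP c1 _] := eqVneq c 1%g; last first.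
  (* The term with index [1] is the commutator subgroup, killed by [gamma] since [C] is abelian. *)
  exists 1%N; suff g1 : forall x, lower_central G 1 x -> gamma x = 1%g.
    by move/g1; rewrite gc.
  move=> x; elim=> {x} [x [y [z [_ ->]]]||x y _ gx _ gy|x _ gx].
  - by rewrite gmulfR; apply/eqP/commgP/C_abelian.
  - exact: gmulf1.
  - by rewrite gmulfM gx gy mulg1.
  - by rewrite gmulfV gx invg1.
have us1 : pi u = pi s by rewrite us c1 !gmulf1 mulg1.
have [N [F [HF F0 Fs _ _]]] := reduced_polyfun reds.
apply: (polyfun_separates HF); rewrite us1 => Fs1; apply: Fs; rewrite Fs1.
apply: (F0 [::]); rewrite lt0n size_eq0; apply/eqP => s0.
by apply: u1; rewrite us1 s0.
Qed.

End Separation.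

Theorem theorem1 (A B C : groupType)
  (iA : {ghom C -> A}) (iB : {ghom C -> B})
  (iA_inj : injective iA) (iB_inj : injective iB)
  (A_tf : torsion_free A) (A_nil : nilpotent_group A)
  (B_tf : torsion_free B) (B_nil : nilpotent_group B)
  (C_retract_A : retract iA) (C_retract_B : retract iB)
  (C_abelian : abelian_group C) :
  residually_nilpotent (amalgam iA iB).
Proof.
apply: residually_nilpotent_lower_central => g.
have [rA rAK] := C_retract_A; have [rB rBK] := C_retract_B.
(* The two retractions agree on [C] and so glue to a retraction of the amalgam onto [C]. *)
have [x|gamma [gammaA gammaB _]] := @amalgam_universal A B C iA iB C rA rB.
  by rewrite rAK rBK.
exact: (amalgam_lower_central_separated rAK rBK gammaA gammaB).
Qed.
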